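(* Let $y_1,\dots,y_k\ge 0$ with $\sum_i y_i=1$. For $n\ge0$ let $E^*_{n,\vec{y}}$ denote expectation with respect to the permutation $w\in S_n$ obtained from the generalized shuffling method on $C_n$ with parameters $y_1,\dots,y_k$ after forgetting signs, and let $N_i(w)$ be the number of $i$-cycles of $w$. Then, as formal power series, \[ \sum_{n \geq 0} u^n E^*_{n,\vec{y}} \Big(\prod_i x_i^{N_i}\Big) = \prod_{i\geq 1} \prod_{j\ge 1,\ j \text{ odd}} \exp\Big(\frac{(u^ix_i/2^i)^j}{ij} \sum_{d|i,\ d \text{ odd}} \mu(d)\, (2 p_{jd}(y))^{i/d}\Big),\] where $\mu$ is the Möbius function and $p_m(y)=\sum_i y_i^m$. Furthermore, the same generating function results if after the shuffle one reverses the order of the cards (i.e. replaces $w$ by $w\circ w_0$, $w_0(i)=n+1-i$).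
   Context: Generalized shuffling method on $C_n$ with parameters $y_1,\dots,y_k$: start with $n$ cards face down; choose $j_1,\dots,j_{2k}$ with probability $\binom{n}{j_1,\dots,j_{2k}}\prod_{i=1}^k y_i^{j_{2i-1}+j_{2i}}$; cut the deck into $2k$ consecutive stacks of sizes $j_1,\dots,j_{2k}$; flip over the even-numbered stacks; then choose uniformly at random one of the $\binom{n}{j_1,\dots,j_{2k}}$ interleavings of the stacks. ''Forgetting signs'' means ignoring which cards are face up, giving a permutation $w\in S_n$. Concretely, $w$ has the law of the following: choose a word $J$ of length $n$ on $\{\pm1,\dots,\pm k\}$ with independent letters, $\pm i$ each having probability $y_i/2$; using the order $1<-1<2<-2<\cdots<k<-k$, assign consecutive blocks of integers $1,2,\dots,n$ to the letter values in this order: the block for a positive value $i$ is placed at the positions of the letter $i$ in increasing order from left to right, and the block for a negative value $-i$ is placed at the positions of the letter $-i$ in decreasing order from left to right; $w(p)$ is the integer placed at position $p$. *)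

(* Defs.v *)
From HB Require Import structures.
From mathcomp Require Import all_boot all_order all_algebra all_fingroup.
From mathcomp Require Import mpoly.
Set Implicit Arguments. Unset Strict Implicit. Unset Printing Implicit Defensive.
Import Order.TTheory GRing.Theory Num.Theory.
Local Open Scope ring_scope.

Definition moebius (d : nat) : int :=
  if all (fun p => logn p d == 1%N) (primes d) then (-1) ^+ size (primes d) else 0.

Definition psum (R : fieldType) (k : nat) (y : 'I_k -> R) (m : nat) : R :=
  \sum_(i < k) y i ^+ m.

(* Letters of the word: (i, b) stands for the letter  i+1  if b = false and
   -(i+1) if b = true.  Rank in the order 1 < -1 < 2 < -2 < ... < k < -k. *)
Definition letter_rank (k : nat) (a : 'I_k * bool) : nat := (2 * a.1 + a.2)%N.

(* The integer (0-based) placed at position p by the word J. *)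
Definition shuffle_val (k n : nat) (J : {ffun 'I_n -> 'I_k * bool}) (p : 'I_n) : nat :=
  (#|[pred q : 'I_n | letter_rank (J q) < letter_rank (J p)]| +
   if (J p).2 then #|[pred q : 'I_n | (p < q) && (J q == J p)]|
   else #|[pred q : 'I_n | (q < p) && (J q == J p)]|)%N.

Definition shuffle_fun (k n : nat) (J : {ffun 'I_n -> 'I_k * bool}) (p : 'I_n) : 'I_n :=
  insubd p (shuffle_val J p).

(* The permutation w attached to J (shuffle_fun J is always a bijection;
   the default 1 of insubd is never used). *)
Definition shuffle_perm (k n : nat) (J : {ffun 'I_n -> 'I_k * bool}) : {perm 'I_n} :=
  insubd (1%g : {perm 'I_n}) [ffun p => shuffle_fun J p].

Definition word_prob (R : fieldType) (k n : nat) (y : 'I_k -> R)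
  (J : {ffun 'I_n -> 'I_k * bool}) : R :=
  \prod_(p < n) (y (J p).1 / 2).

Definition ncycles (n : nat) (s : {perm 'I_n}) (i : nat) : nat :=
  #|[set C in porbits s | #|C| == i]|.

Definition w0 (n : nat) : {perm 'I_n} := perm (@rev_ord_inj n).

(* Coefficient of u^n of the LHS:  E*_{n,y}( prod_i x_i^{N_i(f w)} ), as a
   polynomial in the variables x_1, ..., x_n  ('X_i stands for x_{i+1}).
   f is the post-processing of the permutation (identity, or w |-> w o w0). *)
Definition lhs_coef (R : fieldType) (k : nat) (y : 'I_k -> R) (n : nat)
  (f : {perm 'I_n} -> {perm 'I_n}) : {mpoly R[n]} :=
  \sum_(J : {ffun 'I_n -> 'I_k * bool})
     word_prob y J *: \prod_(i < n) 'X_i ^+ ncycles (f (shuffle_perm J)) i.+1.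

Definition Ssum (R : fieldType) (k : nat) (y : 'I_k -> R) (i j : nat) : R :=
  \sum_(d < i.+1 | (d %| i)%N && odd d) (moebius d)%:~R * (2 * psum y (j * d)) ^+ (i %/ d)%N.

Definition texp (R : fieldType) (n N : nat) (q : {poly {mpoly R[n]}}) : {poly {mpoly R[n]}} :=
  \sum_(m < N.+1) (((m`!)%:R : R)^-1 *: (1 : {mpoly R[n]}))%:P * q ^+ m.

Definition rhs_term (R : fieldType) (k : nat) (y : 'I_k -> R) (n : nat)
  (i0 : 'I_n) (j : nat) : {poly {mpoly R[n]}} :=
  let i := i0.+1 in
  ((Ssum y i j / (2 ^+ (i * j) * (i * j)%:R)) *: 'X_i0 ^+ j)%:P * 'X^(i * j).

(* Coefficient of u^n in  prod_{i>=1} prod_{j odd} exp(rhs_term i j).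
   Only factors with i <= n and j <= n can contribute to u^n, and the
   exponentials may be truncated at order n. *)
Definition rhs_coef (R : fieldType) (k : nat) (y : 'I_k -> R) (n : nat) : {mpoly R[n]} :=
  (\prod_(i0 < n) \prod_(j < n.+1 | odd j) texp n (rhs_term y i0 j))`_n.

(* Main.v *)
Require Import Defs.
From HB Require Import structures.
From mathcomp Require Import all_boot all_order all_algebra all_fingroup cyclic.
From mathcomp Require Import mpoly.
Set Implicit Arguments. Unset Strict Implicit. Unset Printing Implicit Defensive.
Import Order.TTheory GRing.Theory Num.Theory.
Local Open Scope ring_scope.

(* Write f for the inverse of the shuffle w attached to a word J.  The itinerary
   J(f p), J(f^2 p), ... of a position p is a periodic word, and p |-> itinerary
   is weakly increasing for the lexicographic order twisted by the signs, because
   f is increasing on positive blocks and decreasing on negative ones.  Since w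
   acts on itineraries by rotation, this gives a bijection (a signed version of
   the Gessel-Reutenauer bijection) between the words of length n and the
   rotation-invariant multisets of n periodic words.  On the m positions sharing
   a given itinerary of period l, w^l is the identity if the period has positive
   sign and the reversal if it has negative sign; hence a rotation class of
   weight y contributes 1/(1 - y x_l u^l) in the positive case and
   (1 + y x_l u^l)/(1 - y^2 x_(2l) u^(2l)) in the negative case.

   Both sides are then compared through their logarithmic derivatives in u.  Let
   e(i,j), o(i,j) be the sums of y^j over the periodic words of period i and sign
   +, -.  Since the letters i and -i have the same weight, the signed sum of all
   words of a given length vanishes, which yields
   e(i,j) - o(i,j) + 2 o(i/2,2j) = 0; only the terms 2 o(i,j) with j odd survive,
   and they are evaluated by Moebius inversion over odd divisors.

   Nothing depends on the order of the letters, so the reversed shuffle is covered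
   by exchanging i and -i. *)

(** * Orbits of a permutation *)

Section Porbits.
Variables (T : finType) (s : {perm T}).

Lemma big_porbits (R : Type) (idx : R) (op : Monoid.com_law idx) (E : T -> R) :
  \big[op/idx]_x E x = \big[op/idx]_(C in porbits s) \big[op/idx]_(x in C) E x.
Proof.
rewrite (partition_big (porbit s) (mem (porbits s))) /=; last first.
  by move=> x _; apply: imset_f.
apply: eq_bigr => _ /imsetP[x _ ->]; apply: eq_bigl => z.
by rewrite eq_porbit_mem.
Qed.

Lemma big_porbit (R : Type) (idx : R) (op : Monoid.com_law idx) (E : T -> R) x :
  \big[op/idx]_(t < #|porbit s x|) E ((s ^+ t)%g x) =
  \big[op/idx]_(z in porbit s x) E z.
Proof.
have <- : \big[op/idx]_(z <- traject s x #|porbit s x|) E z =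
          \big[op/idx]_(z in porbit s x) E z.
  rewrite big_uniq ?uniq_traject_porbit //=.
  by apply: eq_bigl => z; rewrite porbit_traject.
have -> : traject s x #|porbit s x| =
          [seq (s ^+ t)%g x | t <- iota 0 #|porbit s x|].
  apply: (@eq_from_nth _ x) => [|i]; rewrite ?size_map ?size_iota size_traject //.
  by move=> lti; rewrite (nth_map 0%N) ?size_iota // nth_iota // nth_traject // permX.
by rewrite big_map -(big_mkord xpredT (fun t => E ((s ^+ t)%g x))) /index_iota subn0.
Qed.

Lemma porbit_period x : (s ^+ #|porbit s x|)%g x = x.
Proof. by rewrite permX iter_porbit. Qed.

Lemma porbit_periodM x m : (s ^+ (m * #|porbit s x|))%g x = x.
Proof.
elim: m => [|m IHm]; first by rewrite mul0n expg0 perm1.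
by rewrite mulSn expgD permM porbit_period.
Qed.

Lemma card_porbit_gt0 x : (0 < #|porbit s x|)%N.
Proof. by rewrite card_gt0; apply/set0Pn; exists x; apply: porbit_id. Qed.

Lemma card_porbit_dvd x i : ((s ^+ i)%g x == x) = (#|porbit s x| %| i)%N.
Proof.
apply/eqP/idP => [|/dvdnP[m ->]]; last exact: porbit_periodM.
rewrite {1}(divn_eq i #|porbit s x|) expgD permM porbit_periodM => fixx.
rewrite /dvdn; apply/eqP; set r := (i %% _)%N in fixx *.
have lt_r : (r < #|porbit s x|)%N by rewrite ltn_mod card_porbit_gt0.
have := uniq_traject_porbit s x; move/(nth_uniq x).
move/(_ r 0%N); rewrite size_traject => /(_ lt_r (card_porbit_gt0 x)).
rewrite !nth_traject ?card_porbit_gt0 // -permX fixx eqxx.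
by move/esym/eqP.
Qed.

Lemma prod_porbit (R : comNzRingType) (E : T -> R) x m :
  \prod_(t < m * #|porbit s x|) E ((s ^+ t)%g x) =
  (\prod_(z in porbit s x) E z) ^+ m.
Proof.
elim: m => [|m IHm]; first by rewrite mul0n big_ord0.
rewrite mulSn big_split_ord /= big_porbit exprS; congr (_ * _).
rewrite -IHm; apply: eq_bigr => t _ /=.
by rewrite expgD permM porbit_period.
Qed.

Lemma porbit_eqP x z : z \in porbit s x -> porbit s z = porbit s x.
Proof. by rewrite -eq_porbit_mem => /eqP. Qed.

Lemma porbit_step x : porbit s (s x) = porbit s x.
Proof. by have := porbit_perm s 1 x; rewrite expg1. Qed.

Lemma card_porbits_with i :
  (i * #|[set C in porbits s | #|C| == i]| = #|[set x | #|porbit s x| == i]|)%N.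
Proof.
rewrite -[RHS]sum1_card big_mkcond big_porbits -sum1_card big_distrr /=.
rewrite [LHS]big_mkcond [RHS]big_mkcond; apply: eq_bigr => C _; rewrite !inE.
have [sC|//] := boolP (C \in porbits s); rewrite muln1 /=.
have /imsetP[x _ defC] := sC.
rewrite (eq_bigr (fun _ => if #|C| == i then 1 else 0))%N; last first.
  by move=> z zC; rewrite inE; rewrite defC in zC *; rewrite (porbit_eqP zC).
by case: eqP => [<-|_]; rewrite ?sum1_card // big1.
Qed.

End Porbits.

(** * Permutations that are monotone on an invariant set of positions *)

Section MonotonePermutations.
Variables (n : nat) (C : {set 'I_n}).

(** If [g p] were on one side of [p], all iterates would stay strictly on that side, whereas [g] has
    finite order. *)
Lemma homo_perm_id (g : {perm 'I_n}) :
  {in C, forall p, g p \in C} -> {in C &, forall p q : 'I_n, (p < q)%N -> (g p < g q)%N} ->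
  {in C, forall p, g p = p}.
Proof.
move=> gC g_homo p pC; apply: val_inj; apply/eqP.
have gtC t : (g ^+ t)%g p \in C.
  by elim: t => [|t IHt]; rewrite ?expg0 ?perm1 // expgSr permM gC.
have ord0 : (0 < #[g]%g)%N by rewrite order_gt0.
have fixp : (g ^+ #[g]%g.-1.+1)%g p = p by rewrite prednK // expg_order perm1.
case: (ltngtP (g p) p) => // ltp.
  have lt t : ((g ^+ t.+1)%g p < p)%N.
    elim: t => [|t IHt]; first by rewrite expg1.
    by rewrite expgSr permM; apply: ltn_trans ltp; apply: g_homo.
  by have := lt #[g]%g.-1; rewrite fixp ltnn.
have lt t : (p < (g ^+ t.+1)%g p)%N.
  elim: t => [|t IHt]; first by rewrite expg1.
  by rewrite expgSr permM; apply: (ltn_trans ltp); apply: g_homo.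
by have := lt #[g]%g.-1; rewrite fixp ltnn.
Qed.

Variable g : {perm 'I_n}.
Hypothesis gC : {in C, forall p, g p \in C}.
Hypothesis g_anti : {in C &, forall p q : 'I_n, (p < q)%N -> (g q < g p)%N}.

Lemma anti_perm_involutive : {in C, forall p, g (g p) = p}.
Proof.
move=> p pC; rewrite -permM; apply: homo_perm_id p pC => [p pC | p q pC qC ltpq].
  by rewrite permM !gC.
by rewrite !permM; apply: g_anti; rewrite ?gC //; apply: g_anti.
Qed.

Lemma anti_perm_fix_le1 : (#|[set p in C | g p == p]| <= 1)%N.
Proof.
apply/card_le1_eqP => p q; rewrite !inE => /andP[pC /eqP gp] /andP[qC /eqP gq].
apply: val_inj; case: (ltngtP p q) => // lt.
  by have := g_anti pC qC lt; rewrite gp gq ltnNge ltnW.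
by have := g_anti qC pC lt; rewrite gp gq ltnNge ltnW.
Qed.

Lemma anti_perm_card_moved :
  #|[set p in C | g p != p]| = #|[set p in C | (p < g p)%N]|.*2.
Proof.
have -> : [set p in C | g p != p] =
  [set p in C | (p < g p)%N] :|: [set p in C | (g p < p)%N].
  apply/setP => p; rewrite !inE; case: (p \in C) => //=.
  by rewrite -val_eqE neq_ltn orbC.
rewrite cardsU -addnn.
have -> : [set p in C | (p < g p)%N] :&: [set p in C | (g p < p)%N] = set0.
  apply/setP => p; rewrite !inE; case: (p \in C) => //=.
  by case: ltngtP.
rewrite cards0 subn0; congr addn.
have -> : [set p in C | (g p < p)%N] = g @: [set p in C | (p < g p)%N].
  apply/setP => p; apply/idP/imsetP => [|[q + ->]].
    rewrite inE => /andP[pC lt]; exists (g p); rewrite ?anti_perm_involutive //.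
    by rewrite inE gC //= anti_perm_involutive.
  by rewrite !inE => /andP[qC lt]; rewrite gC //= anti_perm_involutive.
by rewrite card_imset //; apply: perm_inj.
Qed.

(** An order-reversing [g] is an involution on [C] with at most one fixed point, and it exchanges
    the points moved up with those moved down; so the parity of [#|C|] decides whether a fixed point
    exists. *)
Lemma anti_perm_cards :
  (#|[set p in C | g p == p]| = odd #|C|) /\
  (#|[set p in C | g p != p]| = (#|C|./2).*2).
Proof.
have cardC : (#|[set p in C | g p == p]| + #|[set p in C | g p != p]| = #|C|)%N.
  rewrite -[RHS](cardsID [set p | g p == p]); congr addn.
    by apply: eq_card => p; rewrite !inE.
  by apply: eq_card => p; rewrite !inE andbC.
have := anti_perm_fix_le1; rewrite -cardC anti_perm_card_moved.
case: #|[set p in C | g p == p]| => [|[]] // _.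
  by rewrite add0n odd_double doubleK.
by rewrite add1n /= odd_double uphalf_double.
Qed.

End MonotonePermutations.

(** * Shuffles for an arbitrary order and sign of the letters *)

Section Shuffle.
Variables (A : finType) (sg : A -> bool) (rk : A -> nat) (n : nat).
Implicit Types (J : {ffun 'I_n -> A}) (p q r : 'I_n).

(** Kept generic in [sg] and [rk] because the reversed shuffle has this form for another ranking.
    The body copies [shuffle_val], so [shuffle_perm] is an instance by conversion. *)
Definition gen_shuffle_val J p : nat :=
  (#|[pred q : 'I_n | rk (J q) < rk (J p)]| +
   if sg (J p) then #|[pred q : 'I_n | (p < q) && (J q == J p)]|
   else #|[pred q : 'I_n | (q < p) && (J q == J p)]|)%N.

Definition gen_shuffle J : {perm 'I_n} :=
  insubd (1%g : {perm 'I_n}) [ffun p => insubd p (gen_shuffle_val J p)].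

(** The strict total order by which the shuffle sorts positions: the value at [p] counts the
    positions below [p]. *)
Definition shuffle_lt J q p : bool :=
  (rk (J q) < rk (J p))%N || (J q == J p) && (if sg (J p) then p < q else q < p)%N.

Lemma gen_shuffle_valE J p : gen_shuffle_val J p = #|[pred q | shuffle_lt J q p]|.
Proof.
rewrite -[RHS](cardID [pred q | (rk (J q) < rk (J p))%N]) /gen_shuffle_val.
congr addn.
  by apply: eq_card => q; rewrite !inE /shuffle_lt; case: (_ < _)%N; rewrite ?andbF.
case: ifP => sgp; apply: eq_card => q; rewrite !inE /shuffle_lt sgp;
  by case: (eqVneq (J q) (J p)) => [->|_]; rewrite ?ltnn ?andbT ?andbF ?orbF ?andNb.
Qed.

Hypothesis rk_inj : injective rk.

Lemma shuffle_lt_trans J : transitive (shuffle_lt J).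
Proof.
move=> q p r; rewrite /shuffle_lt.
case/orP=> [lt1|/andP[/eqP-> lt1]]; case/orP=> [lt2|/andP[/eqP<- lt2]].
- by rewrite (ltn_trans lt1 lt2).
- by rewrite lt1.
- by rewrite lt2.
- rewrite ltnn eqxx /=; case: ifP lt1 lt2 => _ lt1 lt2; first exact: ltn_trans lt2 lt1.
  exact: ltn_trans lt1 lt2.
Qed.

Lemma shuffle_lt_irr J : irreflexive (shuffle_lt J).
Proof. by move=> p; rewrite /shuffle_lt !ltnn if_same andbF. Qed.

Lemma shuffle_lt_total J p q : p != q -> shuffle_lt J p q || shuffle_lt J q p.
Proof.
rewrite /shuffle_lt -val_eqE neq_ltn => /orP neq.
case: (ltngtP (rk (J p)) (rk (J q))) => [_|_|/rk_inj ->]; rewrite ?orbT //= !eqxx /=.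
by case: ifP => _; case: neq => ->; rewrite ?orbT.
Qed.

Lemma gen_shuffle_val_homo J p q :
  shuffle_lt J p q -> (gen_shuffle_val J p < gen_shuffle_val J q)%N.
Proof.
move=> ltpq; rewrite !gen_shuffle_valE; apply: proper_card.
apply/properP; split.
  by apply/subsetP => r; rewrite !inE => ltrp; apply: shuffle_lt_trans ltpq.
by exists p; rewrite !inE ?shuffle_lt_irr.
Qed.

Lemma gen_shuffle_val_lt J p : (gen_shuffle_val J p < n)%N.
Proof.
rewrite gen_shuffle_valE -[X in (_ < X)%N]card_ord; apply: proper_card.
by apply/properP; split; [apply/subsetP | exists p; rewrite // inE shuffle_lt_irr].
Qed.

(** The values are below [n] and strictly increase along a total order, so neither [insubd] falls
    back on its default. *)
Lemma gen_shuffleE J p : gen_shuffle J p = gen_shuffle_val J p :> nat.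
Proof.
set f := [ffun p => insubd p (gen_shuffle_val J p)] : {ffun 'I_n -> 'I_n}.
have fE q : f q = gen_shuffle_val J q :> nat.
  by rewrite ffunE val_insubd gen_shuffle_val_lt.
have f_inj : injectiveb f.
  apply/injectiveP => q r eqf; apply/eqP/negPn/negP => /(shuffle_lt_total J).
  by case/orP=> /gen_shuffle_val_homo; rewrite -!fE eqf ltnn.
by rewrite -fE -pvalE /gen_shuffle -[pval _]/(val _) insubdK.
Qed.

Lemma gen_shuffle_lt J p q :
  (gen_shuffle J p < gen_shuffle J q)%N = shuffle_lt J p q.
Proof.
rewrite !gen_shuffleE; have [->|neq] := eqVneq p q.
  by rewrite ltnn shuffle_lt_irr.
apply/idP/idP=> [lt|]; last exact: gen_shuffle_val_homo.
case/orP: (shuffle_lt_total J neq) => // /gen_shuffle_val_homo.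
by rewrite ltnNge ltnW.
Qed.

End Shuffle.

(** * The twisted lexicographic order and itineraries *)

Section TwistedOrder.
Variables (A : finType) (sg : A -> bool) (rk : A -> nat).

(* Lexicographic comparison of words of equal length, reversed each time a
   letter of negative sign is passed; [e] is the accumulated sign. *)
Fixpoint twisted_le (e : bool) (s t : seq A) : bool :=
  if s isn't a :: s' then true else
  if t isn't b :: t' then true else
  (if e then rk b < rk a else rk a < rk b)%N ||
  (a == b) && twisted_le (e (+) sg a) s' t'.

Lemma twisted_le_refl e s : twisted_le e s s.
Proof. by elim: s e => //= a s IHs e; rewrite eqxx IHs orbT. Qed.

Lemma twisted_leN e s t : twisted_le (~~ e) s t = twisted_le e t s.
Proof.
elim: s t e => [|a s IHs] [|b t] e //=; rewrite if_neg addNb IHs eq_sym.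
by case: eqP => [->|]; rewrite ?andbF.
Qed.

Lemma twisted_le_rcons e s t a :
  size s = size t -> twisted_le e (rcons s a) (rcons t a) = twisted_le e s t.
Proof.
elim: s t e => [|b s IHs] [|c t] e //= => [_|[eq_sz]]; last by rewrite IHs.
by rewrite eqxx orbT.
Qed.

(** A common last letter does not affect the comparison; once moved to the front it only contributes
    its sign. *)
Lemma twisted_le_rotr e s t a0 : last a0 s = last a0 t -> size s = size t ->
  twisted_le e (rotr 1 s) (rotr 1 t) = twisted_le (e (+) sg (last a0 s)) s t.
Proof.
case/lastP: s => [|s a]; case/lastP: t => [|t b] //; rewrite ?size_rcons //.
rewrite !last_rcons !rotr1_rcons => -> [eq_sz] /=.
by rewrite twisted_le_rcons // eqxx !ltnn if_same.
Qed.

Lemma twisted_le_rotr_lt s t a0 : (rk (last a0 s) < rk (last a0 t))%N ->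
  size s = size t -> twisted_le false (rotr 1 s) (rotr 1 t).
Proof.
case/lastP: s => [|s a]; case/lastP: t => [|t b] //; rewrite ?size_rcons //.
by rewrite !last_rcons !rotr1_rcons /= => ->.
Qed.

Hypothesis rk_inj : injective rk.

Lemma twisted_le_total e s t : twisted_le e s t || twisted_le e t s.
Proof.
elim: s t e => [|a s IHs] [|b t] e //=.
have := IHs t (e (+) sg a).
case: e; case: (ltngtP (rk a) (rk b)) => [_|_|/rk_inj ->]; rewrite ?orbT ?eqxx //=.
Qed.

Lemma twisted_le_anti e s t : size s = size t ->
  twisted_le e s t -> twisted_le e t s -> s = t.
Proof.
elim: s t e => [|a s IHs] [|b t] e //= [eq_sz].
have IH := IHs t (e (+) sg a) eq_sz; rewrite (eq_sym b).
case: e IH => IH; case: (ltngtP (rk a) (rk b)) => [lt|lt|/rk_inj eqab];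
  rewrite /= ?eqab ?eqxx /=; try by [case: eqP => // eqab; rewrite eqab ltnn in lt];
  by rewrite eqab in IH; move=> le1 le2; rewrite IH.
Qed.

Lemma twisted_le_trans e s t u : size s = size t -> size t = size u ->
  twisted_le e s t -> twisted_le e t u -> twisted_le e s u.
Proof.
elim: s t u e => [|a s IHs] [|b t] [|c u] e //= [eq1] [eq2].
case/orP=> [lt1|/andP[/eqP-> le1]]; case/orP=> [lt2|/andP[/eqP<- le2]].
- apply/orP; left; case: e lt1 lt2 => lt1 lt2; first exact: ltn_trans lt2 lt1.
  exact: ltn_trans lt1 lt2.
- by rewrite lt1.
- by rewrite lt2.
- by rewrite eqxx (IHs t) ?orbT.
Qed.

End TwistedOrder.

Section Rotation.
Variables (A : finType) (L : nat).

(** A right rotation, because itineraries run backwards: passing from [p] to [w p] puts [J p], the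
    last letter, in front. *)
Definition rot_word (s : L.-tuple A) : L.-tuple A := [tuple of rotr 1 s].

Lemma rot_word_inj : injective rot_word.
Proof. by move=> s t [] /rotr_inj /val_inj. Qed.

Definition rotp : {perm L.-tuple A} := perm rot_word_inj.

Lemma val_rotp s : val (rotp s) = rotr 1 s.
Proof. by rewrite permE. Qed.

End Rotation.

Section Itinerary.
Variables (A : finType) (sg : A -> bool) (rk : A -> nat) (n : nat).
Hypothesis rk_inj : injective rk.
Variable J : {ffun 'I_n -> A}.

Local Notation w := (gen_shuffle sg rk J).

Fixpoint itin (t : nat) (p : 'I_n) : seq A :=
  if t is t'.+1 then J ((w^-1)%g p) :: itin t' ((w^-1)%g p) else [::].

Lemma size_itin t p : size (itin t p) == t.
Proof. by elim: t p => //= t IHt p; rewrite eqSS IHt. Qed.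

Definition itinerary (L : nat) (p : 'I_n) : L.-tuple A := Tuple (size_itin L p).

Lemma itin_rcons t p :
  itin t.+1 p = rcons (itin t p) (J ((w^-1 ^+ t.+1)%g p)).
Proof.
elim: t p => [|t IHt] p; first by rewrite /= expg1.
have itinS u q : itin u.+1 q = J ((w^-1)%g q) :: itin u ((w^-1)%g q) by [].
by rewrite itinS IHt [itin t.+1 p]itinS rcons_cons (expgS _ t.+1) permM.
Qed.

(** When [p < q], the predecessors of [p] and [q] are ordered by [shuffle_lt]: the first letters
    increase weakly, and on a tie the predecessors compare as the sign of that letter prescribes,
    exactly as in [twisted_le]. *)
Lemma itin_sorted t (p q : 'I_n) :
  (p <= q)%N -> twisted_le sg rk false (itin t p) (itin t q).
Proof.
elim: t p q => // t IHt p q.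
rewrite leq_eqVlt => /orP[/eqP/val_inj->|ltpq]; first exact: twisted_le_refl.
have : shuffle_lt sg rk J ((w^-1)%g p) ((w^-1)%g q).
  by rewrite -(gen_shuffle_lt _ rk_inj) !permKV.
rewrite /shuffle_lt [twisted_le _ _ _ _ _]/=.
case/orP=> [->//|/andP[/eqP-> ]]; rewrite eqxx /=.
case: ifP => _ lt; last by rewrite IHt ?orbT // ltnW.
by rewrite (twisted_leN _ _ false) IHt ?orbT // ltnW.
Qed.

Variable L : nat.
Hypothesis L_gt0 : (0 < L)%N.
Hypothesis wL : (w ^+ L = 1)%g.

(** Since [w ^+ L = 1], the [L]-th backward step returns to [p]. *)
Lemma last_itinerary a0 p : last a0 (itinerary L p) = J p.
Proof.
rewrite /itinerary /=; case: L L_gt0 wL => // L' _ wL'.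
by rewrite itin_rcons last_rcons expgVn wL' invg1 perm1.
Qed.

Lemma itinerary_shuffle p : itinerary L (w p) = rotp A L (itinerary L p).
Proof.
apply: val_inj; rewrite val_rotp /itinerary /=.
case: L L_gt0 wL => // L' _ wL'.
by rewrite [in RHS]itin_rcons expgVn wL' invg1 perm1 rotr1_rcons /= permK.
Qed.

End Itinerary.

(** * Cycle type of a shuffle *)

(** The last letters of the words in a rotation class run once through a primitive period, so this
    is the sign of that period; [a0] is the default required by [last]. *)
Definition orbit_sign (A : finType) (sg : A -> bool) (L : nat) (a0 : A)
    (O : {set L.-tuple A}) : bool :=
  \big[addb/false]_(z in O) sg (last a0 z).

(* The number of [i]-cycles of a shuffle on the positions whose itinerary is in
   a given rotation class of size [l] and sign [e], each word being taken [m]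
   times. *)
Definition cycle_count (e : bool) (l m i : nat) : nat :=
  if e then ((l == i) * odd m + (l.*2 == i) * m./2)%N else ((l == i) * m)%N.

Section CycleType.
Variables (A : finType) (sg : A -> bool) (rk : A -> nat) (n : nat).
Hypothesis rk_inj : injective rk.
Variables (L : nat) (a0 : A) (J : {ffun 'I_n -> A}).

Local Notation w := (gen_shuffle sg rk J).
Local Notation it := (itinerary sg rk J L).
Local Notation rot := (rotp A L).

Hypothesis L_gt0 : (0 < L)%N.
Hypothesis wL : (w ^+ L = 1)%g.

Definition itin_class (s : L.-tuple A) : {set 'I_n} := [set p | it p == s].

Lemma itinerary_shuffleX t p : it ((w ^+ t)%g p) = (rot ^+ t)%g (it p).
Proof.
elim: t => [|t IHt]; first by rewrite !expg0 !perm1.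
by rewrite !expgSr !permM itinerary_shuffle // IHt.
Qed.

Lemma itin_class_shuffleX t s p :
  p \in itin_class s -> (w ^+ t)%g p \in itin_class ((rot ^+ t)%g s).
Proof. by rewrite !inE => /eqP <-; rewrite itinerary_shuffleX. Qed.

Lemma shuffle_lt_class s p q : p \in itin_class s -> q \in itin_class s ->
  (w p < w q)%N = if sg (last a0 s) then (q < p)%N else (p < q)%N.
Proof.
rewrite !inE => /eqP itp /eqP itq; rewrite gen_shuffle_lt // /shuffle_lt.
have lastJ r : J r = last a0 (it r) by rewrite last_itinerary.
by rewrite !lastJ itp itq eqxx ltnn.
Qed.

Lemma shuffleX_lt_class t s p q : p \in itin_class s -> q \in itin_class s ->
  ((w ^+ t)%g p < (w ^+ t)%g q)%N =
  if \big[addb/false]_(i < t) sg (last a0 ((rot ^+ i)%g s))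
  then (q < p)%N else (p < q)%N.
Proof.
elim: t p q => [|t IHt] p q sp sq; first by rewrite big_ord0 expg0 !perm1.
rewrite expgSr !permM (@shuffle_lt_class ((rot ^+ t)%g s)) ?itin_class_shuffleX //.
rewrite !IHt // big_ord_recr /= addbC.
by case: (sg _) => /=; [rewrite if_neg|].
Qed.

(** Itineraries rotate as positions move along [w], so a cycle can only close after a multiple of
    the period. *)
Lemma shuffle_period_class s (l := #|porbit rot s|) p : p \in itin_class s ->
  (l %| #|porbit w p|)%N /\ (((w ^+ l)%g p == p) = (#|porbit w p| == l)).
Proof.
rewrite inE => /eqP itp.
have dvd_l : (l %| #|porbit w p|)%N.
  by rewrite -card_porbit_dvd -itp -itinerary_shuffleX porbit_period.
by rewrite dvd_l card_porbit_dvd [RHS]eqn_dvd dvd_l andbT.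
Qed.

(** [w ^+ l] preserves the class of [s], and it is increasing or decreasing there according to the
    sign of the period. In the first case it is the identity and all cycles have length [l]; in the
    second it is a reversal, whose middle point, if any, lies on an [l]-cycle and whose other points
    lie on [2l]-cycles. *)
Lemma card_itin_class_cycle s i (l := #|porbit rot s|) :
  (l * #|[set p in itin_class s | #|porbit w p| == i]| =
  i * cycle_count (orbit_sign sg a0 (porbit rot s)) l #|itin_class s| i)%N.
Proof.
set g := (w ^+ l)%g.
have gC : {in itin_class s, forall p, g p \in itin_class s}.
  by move=> p /(itin_class_shuffleX l); rewrite porbit_period.
have gE p : p \in itin_class s -> (g p == p) = (#|porbit w p| == l).
  by case/shuffle_period_class.
have lt_g p q : p \in itin_class s -> q \in itin_class s ->
    (g p < g q)%N = if orbit_sign sg a0 (porbit rot s) then (q < p)%N else (p < q)%N.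
  move=> sp sq; rewrite (shuffleX_lt_class l sp sq) /l.
  by rewrite (big_porbit _ _ (fun z : L.-tuple A => sg (last a0 z))).
have l_gt0 : (0 < l)%N by apply: card_porbit_gt0.
rewrite /cycle_count; case: (orbit_sign sg a0 (porbit rot s)) lt_g => lt_g; last first.
  have fix_g p : p \in itin_class s -> #|porbit w p| = l.
    move=> sp; apply/eqP; rewrite -gE //; apply/eqP.
    by apply: homo_perm_id p sp => // p q sp sq ltpq; rewrite lt_g.
  have [<-|ne_li] := eqVneq l i.
    rewrite mul1n; congr muln; apply: eq_card => p; rewrite !inE.
    by case: eqP => //= itp; apply/eqP/fix_g; rewrite inE itp.
  rewrite mul0n muln0; apply/eqP; rewrite muln_eq0 cards_eq0; apply/orP; right.
  apply/eqP/setP => p; rewrite !inE; apply/negP => /andP[sp /eqP porb].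
  by case/eqP: ne_li; rewrite -porb fix_g // inE.
have g_anti : {in itin_class s &, forall p q : 'I_n, (p < q)%N -> (g q < g p)%N}.
  by move=> p q sp sq ltpq; rewrite lt_g.
(* The cycle length is [c * l], and [c] divides 2 because [g] is an involution on the class. *)
have moved_g p : p \in itin_class s -> (g p != p) = (#|porbit w p| == l.*2).
  move=> sp; have [/dvdnP[c porb] _] := shuffle_period_class sp.
  rewrite gE // porb -/l -muln2 mulnC -{2}[l]muln1 !eqn_pmul2l //.
  have : (w ^+ (2 * l))%g p == p.
    rewrite mul2n -addnn expgD permM -/g; apply/eqP.
    exact: (anti_perm_involutive gC g_anti).
  rewrite card_porbit_dvd porb -/l dvdn_pmul2r //.
  have c_gt0 : (0 < c)%N by have := card_porbit_gt0 w p; rewrite porb muln_gt0 => /andP[].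
  by move/(dvdn_leq (isT : 0 < 2)%N); case: c c_gt0 {porb} => [|[|[|]]].
have [card_fix card_moved] := anti_perm_cards gC g_anti.
rewrite mulnDr.
have [eq_li|ne_li] := eqVneq l i.
  have -> : (l.*2 == i) = false.
    by rewrite -eq_li -addnn -[X in _ == X]addn0 eqn_add2l; case: (l) l_gt0.
  rewrite mul1n muln0 addn0 -card_fix -eq_li; congr muln; apply: eq_card => p.
  by rewrite !inE; case: eqP => //= itp; rewrite gE ?inE ?itp.
rewrite mul0n muln0 add0n; have [eq_li|ne_li2] := eqVneq l.*2 i.
  rewrite mul1n -eq_li -doubleMl doubleMr -card_moved.
  congr muln; apply: eq_card => p.
  by rewrite !inE; case: eqP => //= itp; rewrite moved_g ?inE ?itp.
rewrite muln0; apply/eqP; rewrite muln_eq0 cards_eq0; apply/orP; right.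
apply/eqP/setP => p; rewrite !inE; apply/negP => /andP[sp /eqP porb].
have sp' : p \in itin_class s by rewrite inE.
have := moved_g p sp'; rewrite gE // porb.
by rewrite !(eq_sym i) (negPf ne_li) (negPf ne_li2).
Qed.

(** The picked representative is immaterial: [w] maps the class of [s] bijectively onto that of
    [rot s]. *)
Definition orbit_mult (O : {set L.-tuple A}) : nat :=
  if [pick s in O] is Some s then #|itin_class s| else 0%N.

Lemma card_itin_class_rot s : #|itin_class (rot s)| = #|itin_class s|.
Proof.
rewrite -[RHS](card_imset _ (@perm_inj _ w)); apply: eq_card => p.
apply/idP/imsetP => [sp|[q sq ->]].
  exists ((w^-1)%g p); rewrite ?permKV //; move: sp; rewrite !inE => /eqP itp.
  by rewrite -(inj_eq (@perm_inj _ rot)) -itinerary_shuffle // permKV itp.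
by rewrite -[w]expg1 -[rot]expg1 itin_class_shuffleX.
Qed.

Lemma orbit_multE s : orbit_mult (porbit rot s) = #|itin_class s|.
Proof.
rewrite /orbit_mult; case: pickP => [z|/(_ s)]; last by rewrite porbit_id.
move=> /porbitP[i ->]; elim: i => [|i IHi]; first by rewrite expg0 perm1.
by rewrite expgSr permM card_itin_class_rot.
Qed.

(** After multiplication by [i] both sides count the positions lying on [i]-cycles, grouped on the
    right by rotation class. *)
Lemma ncycles_shuffle i : (0 < i)%N ->
  ncycles w i = (\sum_(O in porbits rot)
    cycle_count (orbit_sign sg a0 O) #|O| (orbit_mult O) i)%N.
Proof.
move=> i_gt0; apply/eqP; rewrite -(eqn_pmul2l i_gt0); apply/eqP.
rewrite /ncycles card_porbits_with -sum1_card (partition_big it predT) //=.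
rewrite (big_porbits rot) big_distrr /=; apply: eq_bigr => _ /imsetP[s _ ->].
rewrite orbit_multE -card_itin_class_cycle -sum_nat_const; apply: eq_bigr => z zO.
have [j ->] : exists j, z = (rot ^+ j)%g s by apply/porbitP.
(* All words of a rotation class contribute equally, because [w] carries one itinerary class to the
   next and preserves cycle lengths. *)
rewrite sum1_card; elim: j => [|j IHj].
  rewrite expg0 perm1; apply: eq_card => p.
  by rewrite [LHS]unfold_in !inE andbC.
rewrite -{}IHj expgSr permM; set z' := (rot ^+ j)%g s.
rewrite -[RHS](card_imset _ (@perm_inj _ w)); apply: eq_card => p.
rewrite [LHS]unfold_in inE; apply/idP/imsetP => [/andP[porb itp]|[q + ->]].
  exists ((w^-1)%g p); rewrite ?permKV // unfold_in inE.
  rewrite -(porbit_step w) -(inj_eq (@perm_inj _ rot)) -itinerary_shuffle //.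
  by rewrite !permKV porb.
by rewrite unfold_in inE => /andP[porb /eqP <-]; rewrite porbit_step itinerary_shuffle // porb eqxx.
Qed.

End CycleType.

(** * Shuffles and rotation-invariant multisets *)

(** The factorial serves as a common itinerary length for all shuffles; it is moreover divisible by
    every period up to [n]. *)
Lemma expg_fact n (s : {perm 'I_n}) : (s ^+ n`! = 1)%g.
Proof.
apply/eqP; rewrite -order_dvdn -(card_Sn n) -[X in (_ %| X)%N]cardsT.
exact: order_dvdG (in_setT s).
Qed.

Section Bijection.
Variables (A : finType) (sg : A -> bool) (rk : A -> nat) (n L : nat) (a0 : A).
Hypothesis rk_inj : injective rk.
Hypothesis L_gt0 : (0 < L)%N.
Hypothesis perm_L : forall s : {perm 'I_n}, (s ^+ L = 1)%g.

Local Notation rot := (rotp A L).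
Local Notation word := (L.-tuple A).
Local Notation shuf J := (gen_shuffle sg rk J).
Implicit Types (J : {ffun 'I_n -> A}) (m : {ffun {set word} -> 'I_n.+1}).

Definition word_le : rel word := fun s t => twisted_le sg rk false s t.

Lemma word_le_total : total word_le.
Proof. by move=> s t; apply: twisted_le_total. Qed.

Lemma word_le_trans : transitive word_le.
Proof. by move=> t s u; apply: (@twisted_le_trans _ sg rk false s t u); rewrite !size_tuple. Qed.

Lemma word_le_anti : antisymmetric word_le.
Proof.
move=> s t /andP[le1 le2]; apply: val_inj.
by apply: (twisted_le_anti rk_inj _ le1 le2); rewrite !size_tuple.
Qed.

Lemma word_le_rot (s t : word) : last a0 s = last a0 t ->
  word_le (rot s) (rot t) = if sg (last a0 s) then word_le t s else word_le s t.
Proof.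
move=> eq_last; rewrite /word_le !val_rotp (@twisted_le_rotr _ _ _ _ s t a0) //.
  by rewrite addFb; case: (sg _) => //; rewrite (twisted_leN _ _ false).
by rewrite !size_tuple.
Qed.

Lemma word_le_rot_lt (s t : word) :
  (rk (last a0 s) < rk (last a0 t))%N -> word_le (rot s) (rot t).
Proof.
rewrite /word_le !val_rotp => lt_last.
by rewrite (@twisted_le_rotr_lt _ _ _ s t a0) // !size_tuple.
Qed.

(** The multiset listed in twisted order: its [p]-th word is meant to become the itinerary of
    position [p], so its last letter must be [J p]. *)
Definition sorted_words m : seq word :=
  sort word_le (flatten [seq nseq (m (porbit rot x)) x | x <- enum {: word}]).

Definition word_default : word := [tuple of nseq L a0].

Definition word_of_mult m : {ffun 'I_n -> A} :=
  [ffun p : 'I_n => last a0 (nth word_default (sorted_words m) p)].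

(** The value 0 outside [porbits rot] makes the multiplicity function canonical; [inord] is harmless
    since multiplicities are at most [n]. *)
Definition mult_of_word J : {ffun {set word} -> 'I_n.+1} :=
  [ffun O => if O \in porbits rot then inord (orbit_mult sg rk J O) else ord0].

Lemma count_sorted_words m x : count_mem x (sorted_words m) = m (porbit rot x).
Proof.
rewrite (seq.permP (permEl (perm_sort _ _))) count_flatten -map_comp sumnE big_map.
rewrite big_enum /= (bigD1 x) //= count_nseq /= eqxx mul1n big1 ?addn0 // => z neq.
by rewrite count_nseq /= (negPf neq).
Qed.

Lemma size_sorted_words m :
  size (sorted_words m) = (\sum_(O in porbits rot) #|O| * m O)%N.
Proof.
rewrite size_sort size_flatten /shape -map_comp sumnE big_map big_enum /=.
rewrite (big_porbits rot) /=; apply: eq_bigr => _ /imsetP[s _ ->].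
rewrite -sum_nat_const; apply: eq_bigr => z /porbit_eqP eq_orb.
by rewrite size_nseq eq_orb.
Qed.

Lemma sorted_map_enum (f : 'I_n -> word) :
  (forall p q : 'I_n, (p < q)%N -> word_le (f p) (f q)) ->
  sorted word_le [seq f p | p <- enum 'I_n].
Proof.
move=> f_homo; apply: (@homo_sorted _ _ f (relpre val ltn)) => //.
by rewrite -sorted_map val_enum_ord iota_ltn_sorted.
Qed.

(** The order being antisymmetric, a sorted list is determined by its multiplicities. Both
    directions of the bijection rest on this. *)
Lemma sorted_words_uniq m (s : seq word) : sorted word_le s ->
  (forall x, count_mem x s = m (porbit rot x)) -> sorted_words m = s.
Proof.
move=> s_sorted s_count; apply: (sorted_eq word_le_trans word_le_anti) => //.
  exact: sort_sorted word_le_total _.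
by apply/allP => x _ /=; rewrite count_sorted_words s_count.
Qed.

Section Reconstruct.
Variable m : {ffun {set word} -> 'I_n.+1}.
Hypothesis size_m : size (sorted_words m) = n.

Let t (p : 'I_n) := nth word_default (sorted_words m) p.
Let w := shuf (word_of_mult m).

Let sorted_wordsE : sorted_words m = [seq t p | p <- enum 'I_n].
Proof.
apply: (@eq_from_nth _ word_default); first by rewrite size_map size_enum_ord.
rewrite size_m => i lti; rewrite (nth_map (Ordinal lti)) ?size_enum_ord // /t.
by rewrite nth_enum_ord.
Qed.

Let t_sorted (p q : 'I_n) : (p <= q)%N -> word_le (t p) (t q).
Proof.
rewrite leq_eqVlt => /orP[/eqP/val_inj ->|lt]; first exact: twisted_le_refl.
have sorted_s := sort_sorted word_le_total
  (flatten [seq nseq (m (porbit rot x)) x | x <- enum {: word}]).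
apply: (sorted_ltn_nth word_le_trans word_default sorted_s) => //.
  by rewrite inE size_m.
by rewrite inE size_m.
Qed.

(** Rotating every word and relisting the results along the inverse of [w] yields a sorted list,
    with unchanged multiplicities because [m] depends only on the rotation class; so it is the
    original list. *)
Lemma sorted_words_shuffle p : t (w p) = rot (t p).
Proof.
suff eq_s : sorted_words m = [seq rot (t ((w^-1)%g v)) | v <- enum 'I_n].
  rewrite {1}/t eq_s (nth_map p) ?size_enum_ord // nth_ord_enum.
  by rewrite permK.
apply: sorted_words_uniq => [|x].
  apply: sorted_map_enum => u v ltuv.
  have : shuffle_lt sg rk (word_of_mult m) ((w^-1)%g u) ((w^-1)%g v).
    by rewrite -(gen_shuffle_lt _ rk_inj) !permKV.
  rewrite /shuffle_lt !ffunE -!/(t _).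
  case/orP=> [/word_le_rot_lt //|/andP[/eqP eq_last lt_uv]].
  by rewrite word_le_rot // eq_last; case: (sg _) lt_uv => /ltnW/t_sorted.
have -> : [seq rot (t ((w^-1)%g v)) | v <- enum 'I_n] =
          map rot (map t (map (w^-1)%g (enum 'I_n))) by rewrite -!map_comp.
have perm_w : perm_eq (map (w^-1)%g (enum 'I_n)) (enum 'I_n).
  apply: uniq_perm => [||v]; rewrite ?(map_inj_uniq perm_inj) ?enum_uniq //.
  rewrite mem_enum inE; apply/mapP; exists (w v); rewrite ?mem_enum //.
  by rewrite permK.
rewrite (seq.permP (perm_map _ (perm_map _ perm_w))) -sorted_wordsE count_map.
rewrite -[in RHS](permKV rot x) porbit_step -count_sorted_words.
by apply: eq_count => z /=; rewrite -[RHS](inj_eq (@perm_inj _ rot)) permKV.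
Qed.

(** The word at [q] is the rotation of the word at the predecessor of [q], so its head is the letter
    carried by that predecessor; induction on the prefix length does the rest. *)
Lemma itinerary_word_of_mult p : itinerary sg rk (word_of_mult m) L p = t p.
Proof.
apply: val_inj; suff itin_take r : (r <= L)%N ->
  forall q, itin sg rk (word_of_mult m) r q = take r (t q).
  by rewrite /= itin_take // take_oversize ?size_tuple.
elim: r => [|r IHr] ltr q; first by rewrite take0.
rewrite /= IHr 1?ltnW // -/w ffunE -/(t _).
rewrite -[in RHS](permKV w q) sorted_words_shuffle val_rotp.
have := size_tuple (t ((w^-1)%g q)).
case/lastP: (tval (t ((w^-1)%g q))) => [|s a]; first by move=> eqL; rewrite -eqL in ltr.
rewrite size_rcons last_rcons rotr1_rcons => sizeL; congr (_ :: _).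
by rewrite -cats1 takel_cat // -ltnS sizeL.
Qed.

Lemma card_itin_class_word_of_mult s :
  #|itin_class sg rk (word_of_mult m) s| = m (porbit rot s).
Proof.
rewrite -count_sorted_words sorted_wordsE count_map -sum1_count big_enum_cond /=.
by rewrite -sum1_card; apply: eq_bigl => p; rewrite !inE itinerary_word_of_mult.
Qed.

End Reconstruct.

Lemma mult_of_wordE J s : mult_of_word J (porbit rot s) = #|itin_class sg rk J s| :> nat.
Proof.
rewrite ffunE imset_f // inordK ?orbit_multE //.
by rewrite ltnS -[X in (_ <= X)%N]card_ord max_card.
Qed.

Lemma mult_of_word_total J :
  (\sum_(O in porbits rot) #|O| * mult_of_word J O)%N = n.
Proof.
rewrite -[RHS]card_ord -sum1_card (partition_big (itinerary sg rk J L) predT) //=.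
rewrite (big_porbits rot) /=; apply: eq_bigr => _ /imsetP[s _ ->].
rewrite -sum_nat_const; apply: eq_bigr => z /porbit_eqP <-.
by rewrite mult_of_wordE -sum1_card; apply: eq_bigl => p; rewrite inE.
Qed.

Lemma mult_of_wordK J : word_of_mult (mult_of_word J) = J.
Proof.
suff eq_s : sorted_words (mult_of_word J) =
            [seq itinerary sg rk J L p | p <- enum 'I_n].
  apply/ffunP => p; rewrite ffunE eq_s (nth_map p) ?size_enum_ord // nth_ord_enum.
  exact: last_itinerary.
apply: sorted_words_uniq => [|x].
  by apply: sorted_map_enum => p q /ltnW; apply: itin_sorted.
rewrite mult_of_wordE count_map -sum1_count big_enum_cond /= -sum1_card.
by apply: eq_bigl => p; rewrite !inE.
Qed.

(** This pins down the image of [mult_of_word]. Total size [n] ensures that [sorted_words m] has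
    exactly one word per position. *)
Lemma word_of_multK m :
  (mult_of_word (word_of_mult m) == m) =
  (m \in pfamily ord0 (mem (porbits rot)) (fun=> predT)) &&
  ((\sum_(O in porbits rot) #|O| * m O)%N == n).
Proof.
apply/eqP/andP => [<-|[/pfamilyP[/subsetP m_supp _] /eqP size_m]].
  rewrite mult_of_word_total eqxx; split=> //; apply/pfamilyP; split=> //.
  by apply/subsetP => O; rewrite inE ffunE; case: ifP => //; rewrite eqxx.
rewrite -size_sorted_words in size_m.
apply/ffunP => O; apply: val_inj.
have [/imsetP[s _ ->]|notO] := boolP (O \in porbits rot).
  by rewrite /= mult_of_wordE card_itin_class_word_of_mult.
rewrite ffunE (negPf notO); apply/eqP; rewrite eq_sym; apply: contraR notO.
exact: m_supp.
Qed.

Lemma sum_mult_of_word (R : nmodType) (G : {ffun {set word} -> 'I_n.+1} -> R) :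
  \sum_J G (mult_of_word J) =
  \sum_(m in pfamily ord0 (mem (porbits rot)) (fun=> predT) |
    (\sum_(O in porbits rot) #|O| * m O)%N == n) G m.
Proof.
rewrite (reindex_onto word_of_mult mult_of_word) => [|J _]; last exact: mult_of_wordK.
apply: eq_big => m; first by rewrite /= word_of_multK.
by rewrite word_of_multK => /andP[_]; rewrite -word_of_multK; move/eqP->.
Qed.

End Bijection.

(** * Weighted sum over shuffles as a product over rotation classes *)

Section WeightedSum.
Variables (A : finType) (sg : A -> bool) (rk : A -> nat) (n L : nat) (a0 : A).
Hypothesis rk_inj : injective rk.
Hypothesis L_gt0 : (0 < L)%N.
Hypothesis perm_L : forall s : {perm 'I_n}, (s ^+ L = 1)%g.
Variables (S : comNzRingType) (v : A -> S) (x : nat -> S).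

Local Notation rot := (rotp A L).

Definition orbit_weight (O : {set L.-tuple A}) : S := \prod_(z in O) v (last a0 z).

Definition cycle_monomial (e : bool) (l m : nat) : S :=
  if e then x l ^+ odd m * x l.*2 ^+ m./2 else x l ^+ m.

Definition orbit_poly (O : {set L.-tuple A}) : {poly S} :=
  \sum_(j < n.+1)
    (orbit_weight O ^+ j * cycle_monomial (orbit_sign sg a0 O) #|O| j) *: 'X^(#|O| * j).

(** The alternative [c == 0] covers a cycle length exceeding [n], such as [l.*2] when a word occurs
    only once. *)
Lemma prod_single_index l c : (0 < l)%N -> (l <= n)%N || (c == 0)%N ->
  \prod_(i < n) x i.+1 ^+ ((l == i.+1) * c) = x l ^+ c.
Proof.
move=> l_gt0 /orP[le_ln|/eqP->]; last by rewrite expr0 big1 // => i _; rewrite muln0.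
case: l l_gt0 le_ln => // l _ lt_ln.
rewrite (bigD1 (Ordinal lt_ln)) //= eqxx mul1n big1 ?mulr1 // => i neq.
by rewrite eqSS eq_sym (inj_eq val_inj i (Ordinal lt_ln)) (negPf neq).
Qed.

Lemma prod_cycle_count e l m : (0 < l)%N -> (l * m <= n)%N ->
  \prod_(i < n) x i.+1 ^+ cycle_count e l m i.+1 = cycle_monomial e l m.
Proof.
move=> l_gt0 le_lm; rewrite /cycle_count /cycle_monomial.
have le_ln c : (0 < c)%N -> (c <= m)%N -> (l * c <= n)%N.
  by move=> _ le_cm; apply: leq_trans le_lm; rewrite leq_pmul2l.
case: e; last first.
  apply: prod_single_index => //; case: m le_lm {le_ln} => [|m] le_lm; first by rewrite orbT.
  by rewrite (leq_trans _ le_lm) // leq_pmulr.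
under eq_bigr do rewrite exprD.
rewrite big_split /= !prod_single_index ?double_gt0 //.
  have [le1|gt1] := leqP 2 m; first by rewrite -muln2 le_ln.
  by case: m gt1 {le_lm le_ln} => [|[]] //; rewrite orbT.
case: m le_ln {le_lm} => [|m] le_ln; first by rewrite orbT.
by rewrite -[l]muln1 le_ln.
Qed.

Lemma shuffle_term (J : {ffun 'I_n -> A}) :
  \prod_p v (J p) * \prod_(i < n) x i.+1 ^+ ncycles (gen_shuffle sg rk J) i.+1 =
  \prod_(O in porbits rot)
    (orbit_weight O ^+ mult_of_word sg rk L J O *
     cycle_monomial (orbit_sign sg a0 O) #|O| (mult_of_word sg rk L J O)).
Proof.
have wL := perm_L (gen_shuffle sg rk J).
rewrite big_split /=; congr (_ * _).
  under eq_bigr do rewrite -(last_itinerary L_gt0 wL a0).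
  rewrite (partition_big (itinerary sg rk J L) predT) //= (big_porbits rot) /=.
  apply: eq_bigr => _ /imsetP[s _ ->].
  rewrite mult_of_wordE // -prodrXl; apply: eq_bigr => z /porbit_eqP eq_orb.
  rewrite -mult_of_wordE // -eq_orb mult_of_wordE // -prodr_const.
  apply: eq_big => [p|p]; rewrite ?inE //. by move=> /eqP <-.
under eq_bigr do rewrite (ncycles_shuffle rk_inj a0 L_gt0 wL) // -prodrXr.
rewrite exchange_big /=; apply: eq_bigr => O rotO.
have -> : mult_of_word sg rk L J O = orbit_mult sg rk J O :> nat.
  by have /imsetP[s _ ->] := rotO; rewrite mult_of_wordE // orbit_multE.
apply: prod_cycle_count; first by have /imsetP[s _ ->] := rotO; apply: card_porbit_gt0.
have -> : orbit_mult sg rk J O = mult_of_word sg rk L J O.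
  by have /imsetP[s _ ->] := rotO; rewrite mult_of_wordE // orbit_multE.
rewrite -[X in (_ <= X)%N](mult_of_word_total sg rk L_gt0 perm_L J).
by rewrite (bigD1 O) //= leq_addr.
Qed.

(** Expanding the product amounts to choosing a multiplicity for each rotation class, and the
    coefficient at [n] imposes the total size. *)
Lemma sum_shuffles :
  \sum_(J : {ffun 'I_n -> A}) \prod_p v (J p) *
    \prod_(i < n) x i.+1 ^+ ncycles (gen_shuffle sg rk J) i.+1 =
  (\prod_(O in porbits rot) orbit_poly O)`_n.
Proof.
rewrite (eq_bigr _ (fun J _ => shuffle_term J)).
pose G (m : {ffun {set L.-tuple A} -> 'I_n.+1}) : S :=
  \prod_(O in porbits rot)
    (orbit_weight O ^+ m O * cycle_monomial (orbit_sign sg a0 O) #|O| (m O)).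
rewrite (sum_mult_of_word sg a0 rk_inj L_gt0 perm_L G).
rewrite (big_distr_big_dep ord0) /= coef_sum big_mkcondr; apply: eq_bigr => m _.
rewrite scaler_prod -expr_sum coefZ coefXn eq_sym.
by case: eqP; rewrite ?mulr1 ?mulr0.
Qed.

End WeightedSum.

(** * Logarithmic derivatives modulo a power of X *)

Section LogDerivative.
Variable S : comNzRingType.
Implicit Types (n l : nat) (c : S) (p q r F H : {poly S}).

Definition eqmod_X n p q := forall i, (i < n)%N -> p`_i = q`_i.

Lemma eqmod_XMl n r p q : eqmod_X n p q -> eqmod_X n (r * p) (r * q).
Proof.
move=> eq_pq i ltin; rewrite !coefM; apply: eq_bigr => j _.
by rewrite eq_pq // (leq_ltn_trans _ ltin) // leq_subr.
Qed.

Lemma eqmod_XMr n r p q : eqmod_X n p q -> eqmod_X n (p * r) (q * r).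
Proof. by rewrite ![_ * r]mulrC; apply: eqmod_XMl. Qed.

Lemma eqmod_XD n p q r s :
  eqmod_X n p q -> eqmod_X n r s -> eqmod_X n (p + r) (q + s).
Proof. by move=> eq1 eq2 i lti; rewrite !coefD eq1 // eq2. Qed.

Lemma eqmod_XN n p q : eqmod_X n p q -> eqmod_X n (- p) (- q).
Proof. by move=> eq1 i lti; rewrite !coefN eq1. Qed.

Lemma eqmod_X_trans n p q r : eqmod_X n p q -> eqmod_X n q r -> eqmod_X n p r.
Proof. by move=> eq1 eq2 i lti; rewrite eq1 // eq2. Qed.

Lemma eqmod_X_sym n p q : eqmod_X n p q -> eqmod_X n q p.
Proof. by move=> eq1 i lti; rewrite eq1. Qed.

Lemma eqmod_X_small n p c m : (n <= m)%N -> eqmod_X n (p * (c *: 'X^m)) 0.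
Proof.
move=> le_nm i lti; rewrite -scalerAr coefZ coefMXn coef0.
by rewrite (leq_trans lti le_nm) mulr0.
Qed.

Lemma eqmod_X_deriv n p q : eqmod_X n.+1 p q -> eqmod_X n p^`() q^`().
Proof. by move=> eq_pq i lti; rewrite !coef_deriv eq_pq. Qed.

(** A polynomial with constant term 1 is invertible as a power series. *)
Lemma eqmod_X_cancel n p q r : p`_0 = 1 ->
  eqmod_X n (p * q) (p * r) -> eqmod_X n q r.
Proof.
move=> p0 eq_pqr; elim/ltn_ind => i IHi lti; have := eq_pqr i lti.
rewrite !coefM !big_ord_recl !p0 !mul1r !subn0.
rewrite [X in _ + X](eq_bigr (fun j : 'I_i => p`_(lift ord0 j) * r`_(i - lift ord0 j))).
  by move/addIr.
move=> j _; have lt_i : (i - lift ord0 j < i)%N.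
  by rewrite ltn_subrL (leq_ltn_trans _ (ltn_ord j)).
by rewrite IHi // (ltn_trans lt_i).
Qed.

(** Stated without division, so that truncated polynomials can stand for power series. *)
Definition is_logderiv n F H := eqmod_X n F^`() (F * H).

Lemma is_logderivM n F G H K :
  is_logderiv n F H -> is_logderiv n G K -> is_logderiv n (F * G) (H + K).
Proof.
move=> dF dG; rewrite /is_logderiv derivM.
have -> : F * G * (H + K) = (F * H) * G + F * (G * K).
  by rewrite mulrDr -!mulrA (mulrC G H).
by apply: eqmod_XD; [apply: eqmod_XMr | apply: eqmod_XMl].
Qed.

Lemma is_logderiv_prod n (I : Type) (s : seq I) (P : pred I) (F H : I -> {poly S}) :
  (forall i, P i -> is_logderiv n (F i) (H i)) ->
  is_logderiv n (\prod_(i <- s | P i) F i) (\sum_(i <- s | P i) H i).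
Proof.
move=> dF; elim/big_rec2: _ => [|i G K Pi dG]; last by apply: is_logderivM; first exact: dF.
by move=> i _; rewrite mulr0 -polyC1 derivC.
Qed.

(** The equation gives [i.+1] times the coefficient at [i.+1] in terms of lower ones; absence of
    torsion then allows induction and gains one order of precision. *)
Lemma is_logderiv_inj n F G H K :
  (forall k (z : S), z *+ k.+1 = 0 -> z = 0) ->
  is_logderiv n F H -> is_logderiv n G K -> eqmod_X n H K -> F`_0 = G`_0 ->
  eqmod_X n.+1 F G.
Proof.
move=> torsion_free dF dG eqHK eq0; elim/ltn_ind => [[|i]] IHi lti //.
apply/eqP; rewrite -subr_eq0; apply/eqP/(torsion_free i); rewrite mulrnBl.
rewrite -!coef_deriv dF // dG // !coefM; apply/eqP; rewrite subr_eq0; apply/eqP.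
apply: eq_bigr => j _; rewrite IHi //; last by rewrite (leq_trans (ltn_ord j)) // ltnW.
by rewrite eqHK // (leq_ltn_trans (leq_subr _ _)).
Qed.

Lemma is_logderiv_quot n (P F Q H K : {poly S}) : P`_0 = 1 -> eqmod_X n.+1 (P * F) Q ->
  is_logderiv n P H -> is_logderiv n Q K -> is_logderiv n F (K - H).
Proof.
move=> P0 eqPFQ dP dQ; apply: (eqmod_X_cancel P0).
have -> : P * F^`() = (P * F)^`() - P^`() * F by rewrite derivM addrC addKr.
have -> : P * (F * (K - H)) = (P * F) * K - (P * H) * F.
  by rewrite mulrBr mulrBr -!mulrA (mulrC F H).
apply: eqmod_XD; last by apply: eqmod_XN; apply: eqmod_XMr.
apply: eqmod_X_trans (eqmod_X_deriv eqPFQ) _.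
apply: eqmod_X_trans dQ _; apply: eqmod_XMr; apply: eqmod_X_sym.
by move=> i lti; apply: eqPFQ; apply: ltnW.
Qed.

(* Modulo X^n, the logarithmic derivative of 1 / (1 - c X^l). *)
Definition geom_logderiv n c l : {poly S} :=
  (\sum_(j < n) (c *: 'X^l) ^+ j) * (c *: 'X^l)^`().

Lemma scaleXn_exp c l j : (c *: 'X^l) ^+ j = c ^+ j *: 'X^(l * j) :> {poly S}.
Proof. by rewrite exprZn -exprM. Qed.

Lemma is_logderiv_geom n c l : (0 < l)%N ->
  is_logderiv n (1 - c *: 'X^l) (- geom_logderiv n c l).
Proof.
move=> l_gt0; rewrite /is_logderiv /geom_logderiv; set t := c *: 'X^l.
(* The geometric sum telescopes, and the remaining multiple of [t ^+ n] vanishes modulo [X^n]. *)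
have -> : (1 - t) * (- ((\sum_(j < n) t ^+ j) * t^`())) = - t^`() + t^`() * t ^+ n.
  have -> : (1 - t) * - ((\sum_(j < n) t ^+ j) * t^`()) =
      ((t - 1) * (\sum_(j < n) t ^+ j)) * t^`().
    by rewrite mulrN -mulNr opprB mulrA.
  by rewrite -subrX1 mulrBl mul1r addrC mulrC.
rewrite derivB -polyC1 derivC sub0r -[X in eqmod_X _ X _]addr0.
apply: eqmod_XD => //; apply: eqmod_X_sym; rewrite scaleXn_exp.
by apply: eqmod_X_small; rewrite leq_pmull.
Qed.

Lemma coef_geom_logderiv n c l i : (0 < l)%N -> (i < n)%N ->
  (geom_logderiv n c l)`_i = if (l %| i.+1)%N then c ^+ (i.+1 %/ l) *+ l else 0.
Proof.
move=> l_gt0 lti; rewrite /geom_logderiv derivZ derivXn mulr_suml coef_sum.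
have coef_j (j : nat) :
    ((c *: 'X^l) ^+ j * (c *: ('X^(l.-1) *+ l)))`_i =
    if i.+1 == (l * j.+1)%N then c ^+ j.+1 *+ l else 0.
  rewrite scaleXn_exp -scalerAl -scalerAr scalerA -exprSr mulrnAr -exprD coefZ coefMn.
  rewrite coefXn mulrnAr mulr_natr mulnS.
  have -> : (i == l * j + l.-1)%N = (i.+1 == l + l * j)%N.
    by rewrite -eqSS -addnS prednK // addnC.
  by case: eqP; rewrite ?mulr1n ?mulr0n ?mul0rn.
under eq_bigr do rewrite coef_j.
case: ifP => [/dvdnP[m def_i]|ndvd].
  have m_gt0 : (0 < m)%N by case: m def_i.
  have lt_m : (m.-1 < n)%N.
    rewrite prednK //; apply: leq_trans lti; rewrite def_i; exact: leq_pmulr.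
  rewrite (bigD1 (Ordinal lt_m)) //= prednK // mulnC -def_i eqxx {2}def_i mulnK //.
  rewrite big1 ?addr0 // => j neq; case: eqP => // eq_i.
  case/eqP: neq; apply: val_inj => /=; rewrite -[val j]/(val j).+1.-1; congr _.-1.
  by apply/eqP; rewrite -(eqn_pmul2l l_gt0) -eq_i def_i mulnC.
rewrite big1 // => j _; case: eqP => // eq_i.
by move: ndvd; rewrite eq_i dvdn_mulr.
Qed.

Lemma geom_series_inv n c l : (0 < l)%N ->
  eqmod_X n.+1 ((1 - c *: 'X^l) * \sum_(j < n.+1) c ^+ j *: 'X^(l * j)) 1.
Proof.
move=> l_gt0; rewrite -(eq_bigr _ (fun (j : 'I_n.+1) _ => scaleXn_exp c l j)).
have -> : (1 - c *: 'X^l) * (\sum_(j < n.+1) (c *: 'X^l) ^+ j) =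
          1 + (-1) * (c *: 'X^l) ^+ n.+1.
  by rewrite mulN1r -[RHS]opprB subrX1 -mulNr opprB.
rewrite -[X in eqmod_X _ _ X]addr0; apply: eqmod_XD => //.
by rewrite scaleXn_exp; apply: eqmod_X_small; rewrite leq_pmull.
Qed.

(** By the recurrence of step 2 the product telescopes to its terms at 0 and 1, up to two boundary
    terms of degree above [n]. The double negation matches the shape used in [is_logderiv_geom]. *)
Lemma odd_series_quot n c (b : S) (f : nat -> S) l : (0 < l)%N ->
  f 0%N = 1 -> f 1%N = c -> (forall j, f j.+2 = b * f j) ->
  eqmod_X n.+1 ((1 - b *: 'X^(l.*2)) * \sum_(j < n.+1) f j *: 'X^(l * j))
    (1 - (- c) *: 'X^l).
Proof.
move=> l_gt0 f0 f1 fSS.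
have -> N : (1 - b *: 'X^(l.*2)) * (\sum_(j < N) f j *: 'X^(l * j)) =
    (1 - (- c) *: 'X^l) +
    ((-1) * (f N *: 'X^(l * N)) + (-1) * (f N.+1 *: 'X^(l * N.+1))).
  elim: N => [|N IHN].
    rewrite big_ord0 mulr0 f0 f1 muln0 muln1 expr0 scale1r !mulN1r scaleNr opprK.
    by rewrite -opprD subrr.
  rewrite big_ord_recr /= mulrDr {}IHN fSS.
  have -> : (1 - b *: 'X^(l.*2)) * (f N *: 'X^(l * N)) =
     f N *: 'X^(l * N) + (-1) * ((b * f N) *: 'X^(l * N.+2)).
    rewrite mulrBl mul1r mulN1r; congr (_ - _).
    by rewrite -scalerAl -scalerAr scalerA -exprD -muln2 -mulnDr.
  rewrite !mulN1r -!addrA; congr (_ + (_ + _)).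
  by rewrite [X in _ + X]addrCA addKr.
rewrite -[X in eqmod_X _ _ X]addr0; apply: eqmod_XD => //.
rewrite -[X in eqmod_X _ _ X]addr0; apply: eqmod_XD; apply: eqmod_X_small.
  by rewrite leq_pmull.
by apply: ltnW; rewrite leq_pmull.
Qed.

End LogDerivative.

(** * Logarithmic derivative of the factor of one rotation class *)

Section OrbitLogDerivative.
Variables (A : finType) (sg : A -> bool) (n L : nat) (a0 : A).
Variables (S : comNzRingType) (v : A -> S) (x : nat -> S).
Variable O : {set L.-tuple A}.
Hypothesis O_gt0 : (0 < #|O|)%N.

Local Notation y := (orbit_weight a0 v O).
Local Notation l := #|O|.

(** For negative sign, the two terms come from the denominator and the numerator of [(1 + y x_l u^l)
    / (1 - y^2 x_(2l) u^(2l))]. *)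
Definition orbit_logderiv : {poly S} :=
  if orbit_sign sg a0 O
  then geom_logderiv n (y ^+ 2 * x l.*2) l.*2 - geom_logderiv n (- (y * x l)) l
  else geom_logderiv n (y * x l) l.

Lemma is_logderiv_orbit_poly :
  is_logderiv n (orbit_poly sg n a0 v x O) orbit_logderiv.
Proof.
rewrite /orbit_poly /orbit_logderiv /cycle_monomial; case: ifP => _.
  have l2_gt0 : (0 < l.*2)%N by rewrite double_gt0.
  rewrite addrC -[X in _ + X]opprK.
  pose f j := y ^+ j * (x l ^+ odd j * x l.*2 ^+ j./2).
  apply: (is_logderiv_quot _ _ (is_logderiv_geom _ l2_gt0) (is_logderiv_geom _ O_gt0)).
    by rewrite coefB coefZ coefXn coef1 (ltn_eqF l2_gt0) mulr0 subr0.
  apply: (@odd_series_quot _ n (y * x l) _ f) => //.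
  - by rewrite /f !expr0 !mulr1.
  - by rewrite /f !expr1 expr0 mulr1.
  - move=> j; rewrite /f /= negbK -[j.+2]/(2 + j)%N exprD (exprS (x _)).
    by rewrite (mulrCA _ (x _)) mulrACA.
rewrite -[geom_logderiv _ _ _]opprK -[- - _]add0r.
rewrite (eq_bigr (fun j : 'I_n.+1 => (y * x l) ^+ j *: 'X^(l * j))); last first.
  by move=> j _; rewrite exprMn.
apply: (is_logderiv_quot _ (geom_series_inv _ O_gt0) (is_logderiv_geom _ O_gt0)).
  by rewrite coefB coefZ coefXn coef1 (ltn_eqF O_gt0) mulr0 subr0.
by move=> i _; rewrite mulr0 -polyC1 derivC.
Qed.

Lemma coef0_orbit_poly : (orbit_poly sg n a0 v x O)`_0 = 1.
Proof.
rewrite /orbit_poly coef_sum big_ord_recl big1 => [|j _].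
  rewrite coefZ coefXn muln0 eqxx /cycle_monomial !expr0.
  by case: ifP; rewrite ?mulr1 addr0.
by rewrite coefZ coefXn ltn_eqF ?mulr0 // muln_gt0 O_gt0.
Qed.

Lemma coef_orbit_logderiv i : (i < n)%N ->
  orbit_logderiv`_i =
  if orbit_sign sg a0 O
  then (if (l.*2 %| i.+1)%N then (y ^+ 2 * x l.*2) ^+ (i.+1 %/ l.*2)%N *+ l.*2 else 0) -
       (if (l %| i.+1)%N then (- (y * x l)) ^+ (i.+1 %/ l)%N *+ l else 0)
  else (if (l %| i.+1)%N then (y * x l) ^+ (i.+1 %/ l)%N *+ l else 0).
Proof.
move=> lti; rewrite /orbit_logderiv; case: ifP => _.
  by rewrite coefB !coef_geom_logderiv ?double_gt0.
by rewrite coef_geom_logderiv.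
Qed.

End OrbitLogDerivative.

(** * Truncated exponentials of monomials *)

Section TruncatedExp.
Variables (R : numFieldType) (n N : nat) (c : {mpoly R[n]}) (e : nat).
Hypothesis e_gt0 : (0 < e)%N.
Let q : {poly {mpoly R[n]}} := c *: 'X^e.

(** Differentiation loses only the top term of the exponential, a multiple of [q ^+ N], hence zero
    modulo [X^N]. *)
Lemma is_logderiv_texp : is_logderiv N (texp N q) q^`().
Proof.
pose C m : {poly {mpoly R[n]}} := (((m`!)%:R : R)^-1 *: (1 : {mpoly R[n]}))%:P.
have C_S m : C m.+1 *+ m.+1 = C m.
  rewrite /C -polyCMn scalerMnl -[X in (X *: _)%:P]mulr_natr; congr (_ *: _)%:P.
  have neq0 k : (k.+1)%:R != 0 :> R by rewrite pnatr_eq0.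
  by rewrite factS natrM invfM mulrAC mulVf // mul1r.
have texp_deriv : (texp N q)^`() = (texp N q - C N * q ^+ N) * q^`().
  have -> : texp N q - C N * q ^+ N = \sum_(m < N) C m * q ^+ m.
    by rewrite /texp big_ord_recr /= addrK.
  rewrite /texp big_ord_recl derivD expr0 mulr1 derivC add0r linear_sum mulr_suml.
  apply: eq_bigr => m _; rewrite /= derivM derivC mul0r add0r deriv_exp /=.
  by rewrite -[bump _ _]/(m.+1) mulrnAr -/(C m.+1) -mulrnAl C_S -mulrA (mulrC q^`()).
rewrite /is_logderiv texp_deriv mulrBl -[X in eqmod_X _ _ X]addr0.
apply: eqmod_XD => //; rewrite -[X in eqmod_X _ _ X]oppr0; apply: eqmod_XN.
rewrite mulrAC scaleXn_exp; apply: eqmod_X_small; exact: leq_pmull.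
Qed.

Lemma coef0_texp : (texp N q)`_0 = 1.
Proof.
rewrite /texp coef_sum big_ord_recl big1 => [|m _].
  by rewrite expr0 mulr1 coefC eqxx fact0 invr1 scale1r addr0.
by rewrite coefCM scaleXn_exp coefZ coefXn ltn_eqF ?mulr0 ?mulr0 // muln_gt0 e_gt0.
Qed.

End TruncatedExp.

(** * Divisor sums and Moebius inversion *)

Section DivisorSums.
Variable V : zmodType.
Implicit Types (F : nat -> V) (P : pred nat).

Lemma sum_divisors_ord N B P F : (0 < N <= B)%N ->
  \sum_(d < B.+1 | (d %| N)%N && P d) F d = \sum_(d <- divisors N | P d) F d.
Proof.
move=> /andP[N_gt0 le_NB]; rewrite -(big_mkord (fun d => (d %| N)%N && P d) F) -big_filter_cond.
apply: perm_big; apply: uniq_perm; rewrite ?filter_uniq ?iota_uniq ?divisors_uniq //.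
move=> d; rewrite mem_filter mem_index_iota -dvdn_divisors //=.
by rewrite andb_idr // => dN; rewrite ltnS (leq_trans _ le_NB) // dvdn_leq.
Qed.

Lemma sum_codivisor N F : (0 < N)%N ->
  \sum_(l <- divisors N) F l = \sum_(d <- divisors N) F (N %/ d)%N.
Proof.
move=> N_gt0; rewrite -[RHS](big_map (divn N) xpredT F); apply: perm_big.
have inv d : d \in divisors N -> (N %/ (N %/ d))%N = d.
  by rewrite -dvdn_divisors // => dN; rewrite divnA // mulKn.
apply: uniq_perm => [||l]; rewrite ?divisors_uniq //.
  rewrite map_inj_in_uniq ?divisors_uniq // => a b aN bN eq_ab.
  by rewrite -(inv a) // -(inv b) // eq_ab.
apply/idP/mapP => [lN|[d + ->]]; last by rewrite -!dvdn_divisors //; apply: dvdn_div.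
exists (N %/ l)%N; rewrite ?inv // -dvdn_divisors //.
by rewrite -dvdn_divisors // in lN; apply: dvdn_div.
Qed.

Lemma sum_multiples N d P F : (0 < N)%N -> (d %| N)%N ->
  \sum_(c <- divisors N | (d %| c)%N && P c) F c =
  \sum_(m <- divisors (N %/ d) | P (d * m)%N) F (d * m)%N.
Proof.
move=> N_gt0 dN; have d_gt0 := dvdn_gt0 N_gt0 dN.
have Nd_gt0 : (0 < N %/ d)%N by rewrite divn_gt0 // dvdn_leq.
rewrite -big_filter_cond -[RHS](big_map (muln d) P F); apply: perm_big.
apply: uniq_perm => [||c]; rewrite ?filter_uniq ?divisors_uniq //.
  rewrite map_inj_uniq ?divisors_uniq // => a b /eqP.
  by rewrite eqn_pmul2l // => /eqP.
rewrite mem_filter -dvdn_divisors //; apply/andP/mapP => [[/dvdnP[m ->] mN]|[m + ->]].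
  exists m; rewrite 1?mulnC // -dvdn_divisors //.
  by rewrite -(dvdn_pmul2r d_gt0) divnK.
by rewrite -dvdn_divisors // => mN; rewrite dvdn_mulr // mulnC -dvdn_divRL.
Qed.

Lemma sum_even_codivisors N F : (0 < N)%N -> (2 %| N)%N ->
  \sum_(l <- divisors N | (2 %| N %/ l)%N) F l = \sum_(l <- divisors (N %/ 2)) F l.
Proof.
move=> N_gt0 N2; rewrite -big_filter; apply: perm_big.
apply: uniq_perm; rewrite ?filter_uniq ?divisors_uniq // => l.
have N2_gt0 : (0 < N %/ 2)%N by rewrite divn_gt0 // dvdn_leq.
rewrite mem_filter -!dvdn_divisors // [RHS]dvdn_divRL //.
apply/andP/idP => [[l2 lN]|lN]; first by rewrite mulnC -dvdn_divRL.
have lN1 : (l %| N)%N by apply: dvdn_trans lN; apply: dvdn_mulr.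
by rewrite dvdn_divRL // mulnC.
Qed.

End DivisorSums.

Lemma moebiusMp p d : prime p -> (0 < d)%N ->
  moebius (p * d) = if (p %| d)%N then 0 else - moebius d.
Proof.
move=> p_pr d_gt0; have p_gt0 := prime_gt0 p_pr.
have pd_gt0 : (0 < p * d)%N by rewrite muln_gt0 p_gt0.
rewrite /moebius; have [p_d|p_d] := boolP (p %| d)%N.
  rewrite ifF //; apply/negbTE/allPn; exists p.
    by rewrite mem_primes p_pr pd_gt0 dvdn_mulr.
  by rewrite lognM // logn_prime // eqxx add1n eqSS -lt0n logn_gt0 mem_primes p_pr d_gt0.
have p_primes : p \notin primes d by rewrite mem_primes p_pr d_gt0.
have perm_pd : perm_eq (primes (p * d)) (p :: primes d).
  apply: uniq_perm; rewrite /= ?primes_uniq ?p_primes // => q.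
  by rewrite primesM // primes_prime // !inE.
rewrite (perm_all _ perm_pd) (perm_size perm_pd) /=.
rewrite lognM // logn_prime // eqxx (eqP (_ : logn p d == 0%N)) /=; last first.
  by rewrite -leqn0 leqNgt logn_gt0.
rewrite exprS mulN1r (eq_in_all (_ : {in primes d, _ =1 (fun q => logn q d == 1%N)})).
  by case: ifP => _ //; rewrite oppr0.
move=> q q_d /=; rewrite lognM // logn_prime //.
by have [eq_qp|//] := eqVneq q p; rewrite eq_qp (negPf p_primes) in q_d.
Qed.

(** For a prime factor [p] of [m], a divisor prime to [p] cancels against its product with [p], and
    multiples of [p^2] contribute 0. *)
Lemma sum_moebius m : (0 < m)%N ->
  \sum_(d <- divisors m) moebius d = if m == 1%N then 1 else 0.
Proof.
move=> m_gt0; case: eqP => [->|/eqP m_neq1]; first by rewrite big_seq1.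
have m_gt1 : (1 < m)%N by rewrite ltn_neqAle eq_sym m_neq1.
set p := pdiv m; have p_pr : prime p by apply: pdiv_prime.
have p_m : (p %| m)%N by apply: pdiv_dvd.
have mp_gt0 : (0 < m %/ p)%N by rewrite divn_gt0 ?prime_gt0 // dvdn_leq.
rewrite (bigID (fun d => p %| d)%N) /=.
have -> : \sum_(d <- divisors m | (p %| d)%N) moebius d =
          \sum_(d <- divisors (m %/ p)) moebius (p * d).
  by rewrite -(sum_multiples predT) //; apply: eq_bigl => d; rewrite andbT.
rewrite [X in X + _]big_seq_cond.
rewrite (eq_bigr (fun d => if (p %| d)%N then 0 else - moebius d)); last first.
  move=> d /andP[+ _]; rewrite -dvdn_divisors // => dm.
  by rewrite moebiusMp // (dvdn_gt0 mp_gt0).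
rewrite -big_seq_cond (eq_bigr (fun d => if ~~ (p %| d)%N then - moebius d else 0)); last first.
  by move=> d _; rewrite if_neg.
rewrite -big_mkcond /= sumrN addrC; apply/eqP; rewrite subr_eq0; apply/eqP.
rewrite -big_filter -[RHS]big_filter; apply: perm_big.
apply: uniq_perm; rewrite ?filter_uniq ?divisors_uniq // => d.
rewrite !mem_filter -!dvdn_divisors //; case p_d : (p %| d)%N => //=.
by rewrite -{1}(divnK p_m) Gauss_dvdl // coprime_sym prime_coprime // p_d.
Qed.

(** Grouping by [c = d * m] leaves the Moebius sum over the divisors of [c], all odd when [c] is, so
    only [c = 1] survives. *)
Lemma odd_moebius_inversion (V : zmodType) (G T : nat -> nat -> V) (B : nat) :
  (forall i j, (0 < i <= B)%N ->
    T i j = \sum_(m <- divisors i | odd m) G (i %/ m)%N (j * m)%N) ->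
  forall i j, (0 < i <= B)%N ->
    \sum_(d <- divisors i | odd d) T (i %/ d)%N (j * d)%N *~ moebius d = G i j.
Proof.
move=> defT i j /andP[i_gt0 le_iB].
pose H c := G (i %/ c)%N (j * c)%N.
transitivity (\sum_(d <- divisors i | odd d)
    \sum_(c <- divisors i | (d %| c)%N && odd c) H c *~ moebius d).
  rewrite [LHS]big_seq_cond [RHS]big_seq_cond; apply: eq_bigr => d /andP[+ odd_d].
  rewrite -dvdn_divisors // => d_i; have d_gt0 := dvdn_gt0 i_gt0 d_i.
  rewrite defT; last first.
    by rewrite divn_gt0 // dvdn_leq //= (leq_trans (leq_div _ _)).
  rewrite sum_multiples // mulrz_suml; apply: eq_big => [m|m _].
    by rewrite oddM odd_d.
  by rewrite /H divnMA mulnA.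
rewrite (exchange_big_dep odd) /=; last by move=> d c _ /andP[].
transitivity (\sum_(c <- divisors i | odd c) H c *~ (if c == 1%N then 1 else 0)).
  rewrite [LHS]big_seq_cond [RHS]big_seq_cond; apply: eq_bigr => c /andP[+ odd_c].
  rewrite -dvdn_divisors // => c_i; have c_gt0 := dvdn_gt0 i_gt0 c_i.
  rewrite -sum_moebius // mulrz_sumr; apply: esym.
  rewrite -[LHS]big_filter -[RHS]big_filter; apply: perm_big.
  apply: uniq_perm; rewrite ?filter_uniq ?divisors_uniq // => d.
  rewrite !mem_filter -!dvdn_divisors //= odd_c andbT.
  have [d_c|] /= := boolP (d %| c)%N; last by rewrite andbF.
  by rewrite (dvdn_trans d_c c_i) (dvdn_odd d_c).
rewrite -big_filter (bigD1_seq 1%N) /=; last 2 first.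
- by rewrite mem_filter /= divisor1.
- by rewrite filter_uniq ?divisors_uniq.
rewrite big1 ?addr0 => [|c /negPf->]; last by rewrite mulr0z.
by rewrite mulr1z /H divn1 muln1.
Qed.

(** The summand is [e - o], plus [2 o] when [i %/ l] is even, that is, when [l] divides [i %/ 2].
    The hypothesis thus says that the divisor sums of the left-hand side [D] vanish, and strong
    induction isolates the term [l = i]. *)
Lemma parity_inversion (V : zmodType) (e o : nat -> nat -> V) (B : nat) :
  (forall i j, (0 < i)%N -> (i %| B)%N ->
    \sum_(l <- divisors i) (if odd (i %/ l)%N
       then e l (j * (i %/ l))%N - o l (j * (i %/ l))%N
       else e l (j * (i %/ l))%N + o l (j * (i %/ l))%N) = 0) ->
  forall i j, (0 < i)%N -> (i %| B)%N ->
    e i j - o i j + (if (2 %| i)%N then o (i %/ 2)%N (2 * j)%N *+ 2 else 0) = 0.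
Proof.
move=> sum0; pose D i j := e i j - o i j +
  (if (2 %| i)%N then o (i %/ 2)%N (2 * j)%N *+ 2 else 0).
suff DE i j : (0 < i)%N -> (i %| B)%N -> \sum_(l <- divisors i) D l (j * (i %/ l))%N = 0.
  elim/ltn_ind => i IHi j i_gt0 iB; have := DE i j i_gt0 iB.
  rewrite (bigD1_seq i) ?divisors_uniq -?dvdn_divisors //= divnn i_gt0 muln1.
  rewrite big_seq_cond big1 ?addr0 // => l /andP[+ neq].
  rewrite -dvdn_divisors // => li; apply: IHi; last exact: dvdn_trans li iB.
    by rewrite ltn_neqAle neq dvdn_leq.
  exact: dvdn_gt0 li.
move=> i_gt0 iB; rewrite -[RHS](sum0 i j) //.
have split_e l : (if odd (i %/ l)%N
       then e l (j * (i %/ l))%N - o l (j * (i %/ l))%N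
       else e l (j * (i %/ l))%N + o l (j * (i %/ l))%N) =
    (e l (j * (i %/ l))%N - o l (j * (i %/ l))%N) +
    (if (2 %| i %/ l)%N then o l (j * (i %/ l))%N *+ 2 else 0).
  by rewrite dvdn2; case: odd; rewrite /= ?addr0 // mulr2n addrA subrK.
rewrite [RHS](eq_bigr _ (fun l _ => split_e l)) !big_split /=; congr (_ + _).
rewrite -!big_mkcond /=.
have [i2|i_odd] := boolP (2 %| i)%N.
  rewrite sum_even_codivisors //.
  rewrite (eq_bigl (fun l => (2 %| l) && true)%N) => [|l]; last by rewrite andbT.
  rewrite sum_multiples // big_seq [RHS]big_seq; apply: eq_bigr => l.
  have i2_gt0 : (0 < i %/ 2)%N by rewrite divn_gt0 // dvdn_leq.
  rewrite -dvdn_divisors // => li; rewrite mulKn // mulnCA divnMA.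
  by rewrite muln_divA // [(2 * _)%N]mulnC divnK.
rewrite !big1_seq // => l /andP[l2]; rewrite -dvdn_divisors // => li.
  by case/negP: i_odd; apply: dvdn_trans l2 (dvdn_div li).
by case/negP: i_odd; apply: dvdn_trans l2 li.
Qed.

(** * Periodic words *)

Section PeriodicWords.
Variables (A : finType) (L : nat) (a0 : A).
Hypothesis L_gt0 : (0 < L)%N.
Local Notation rot := (rotp A L).
Local Notation word := (L.-tuple A).
Implicit Types (s : word) (t : nat).

(** Letters of [s] read from the end; indexing by rotations extends them periodically to all [t]. *)
Definition letter s t : A := last a0 ((rot ^+ t)%g s).

Lemma rev_rotpX s t : (t <= L)%N -> rev ((rot ^+ t)%g s) = seq.rot t (rev s).
Proof.
elim: t => [|t IHt] lt_t; first by rewrite expg0 perm1 rot0.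
by rewrite expgSr permM val_rotp rev_rotr IHt 1?ltnW // -rotS // size_rev size_tuple.
Qed.

Lemma letter_nth s t : (t < L)%N -> letter s t = nth a0 (rev s) t.
Proof.
move=> ltt; rewrite /letter -[LHS]/(last a0 (val _)).
have -> (r : word) : last a0 r = nth a0 (rev r) 0.
  have sz : (0 < size r)%N by rewrite size_tuple.
  by rewrite nth_rev // subn1 nth_last; case: (val r) sz.
rewrite rev_rotpX 1?ltnW // /seq.rot nth_cat size_drop size_rev size_tuple.
by rewrite subn_gt0 ltt nth_drop addn0.
Qed.

Lemma letter_mod s t : letter s t = letter s (t %% L).
Proof.
rewrite /letter {1}(divn_eq t L) expgD permM.
suff rotL m : (rot ^+ (m * L))%g = 1%g by rewrite rotL perm1.
have rot_L : (rot ^+ L)%g = 1%g.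
  apply/permP => r; apply: val_inj; apply: (can_inj revK) => /=.
  by rewrite rev_rotpX // perm1 rot_oversize // size_rev size_tuple.
by rewrite mulnC expgM rot_L expg1n.
Qed.

Lemma letter_inj s s' : (forall t, letter s t = letter s' t) -> s = s'.
Proof.
move=> eq_l; apply: val_inj; apply: (can_inj revK).
apply: (@eq_from_nth _ a0); rewrite ?size_rev ?size_tuple // => t ltt.
by rewrite -!letter_nth.
Qed.

Definition periodic_word i (u : {ffun 'I_i -> A}) : word :=
  [tuple of rev [tuple (if insub (t %% i)%N is Some t' then u t' else a0) | t < L]].

Lemma letter_periodic_word i (u : {ffun 'I_i -> A}) t : (i %| L)%N ->
  letter (periodic_word u) t = if insub (t %% i)%N is Some t' then u t' else a0.
Proof.
move=> iL; rewrite letter_mod; have ltt : (t %% L < L)%N by rewrite ltn_mod.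
rewrite letter_nth // revK -[X in nth _ _ X]/(val (Ordinal ltt)) -tnth_nth tnth_mktuple /=.
by rewrite modn_dvdm.
Qed.

(** A word fixed by [rot ^+ i] amounts to a free choice of [i] letters, so the power expands by
    distributivity. *)
Lemma sum_periodic_words (S : comNzRingType) (phi : A -> S) i :
  (0 < i)%N -> (i %| L)%N ->
  \sum_(s | (rot ^+ i)%g s == s) \prod_(t < i) phi (letter s t) = (\sum_a phi a) ^+ i.
Proof.
move=> i_gt0 iL.
rewrite -[i in RHS]card_ord -prodr_const bigA_distr_bigA /=.
pose h (s : word) : {ffun 'I_i -> A} := [ffun t : 'I_i => letter s t].
have letter_u (u : {ffun 'I_i -> A}) (t : 'I_i) : letter (periodic_word u) t = u t.
  rewrite letter_periodic_word // modn_small //.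
  by case: insubP => [t' _ /val_inj->|]; rewrite ?ltn_ord.
rewrite (reindex_onto (@periodic_word i) h) => [|s /eqP fix_s].
  apply: eq_big => [u|u _]; last by apply: eq_bigr => t _; rewrite letter_u.
  apply/andP; split; last by apply/eqP/ffunP => t; rewrite ffunE letter_u.
  apply/eqP; apply: letter_inj => t; rewrite {1}/letter -permM -expgD -/(letter _ _).
  by rewrite !letter_periodic_word // modnDl.
apply: letter_inj => t; rewrite letter_periodic_word //.
case: insubP => [t' _ def_t'|]; last by rewrite ltn_mod i_gt0.
have fix_sM m : (rot ^+ (m * i))%g s = s.
  by elim: m => [|m IHm]; rewrite ?mul0n ?expg0 ?perm1 // mulSn expgD permM fix_s.
by rewrite ffunE def_t' /letter [in RHS](divn_eq t i) expgD permM fix_sM.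
Qed.

(** The words fixed by [rot ^+ i] are those whose class size divides [i], and their [i] letters
    traverse the period [i %/ #|O|] times. *)
Lemma sum_porbit_words (S : comNzRingType) (phi : A -> S) i :
  (0 < i)%N -> (i %| L)%N ->
  \sum_(O in porbits rot | (#|O| %| i)%N)
    (\prod_(z in O) phi (last a0 z)) ^+ (i %/ #|O|) *+ #|O| = (\sum_a phi a) ^+ i.
Proof.
move=> i_gt0 iL; rewrite -sum_periodic_words // [RHS]big_mkcond (big_porbits rot) /=.
rewrite big_mkcondr; apply: eq_bigr => _ /imsetP[s _ ->].
transitivity (\sum_(z in porbit rot s) (if (#|porbit rot s| %| i)%N then
    (\prod_(z in porbit rot s) phi (last a0 z)) ^+ (i %/ #|porbit rot s|) else 0)).
  by rewrite sumr_const; case: ifP => // _; rewrite mul0rn.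
apply: eq_bigr => z /porbit_eqP eq_orb; rewrite card_porbit_dvd eq_orb; case: ifP => // l_i.
rewrite -eq_orb -(prod_porbit _ (fun r : word => phi (last a0 r))).
by rewrite eq_orb divnK.
Qed.

End PeriodicWords.

(** * Sums over periodic words of given period and sign *)

Section ParitySums.
Variables (A : finType) (sg : A -> bool) (L : nat) (a0 : A).
Hypothesis L_gt0 : (0 < L)%N.
Variables (S : comNzRingType) (v : A -> S).
Local Notation rot := (rotp A L).

(** These are [e(i,j)] for [false] and [o(i,j)] for [true]; the factor [i] counts the words of each
    class. *)
Definition parity_sum (e : bool) (i j : nat) : S :=
  \sum_(O in porbits rot | (#|O| == i) && (orbit_sign sg a0 O == e))
    orbit_weight a0 v O ^+ j *+ i.

Lemma sum_by_size (V : zmodType) (f : {set L.-tuple A} -> V) N : (0 < N)%N ->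
  \sum_(O in porbits rot | (#|O| %| N)%N) f O =
  \sum_(l <- divisors N) \sum_(O in porbits rot | #|O| == l) f O.
Proof.
move=> N_gt0; rewrite (exchange_big_dep (mem (porbits rot))) => [|l O _ /andP[]//] /=.
rewrite big_mkcondr; apply: eq_bigr => O rotO; rewrite rotO /=.
rewrite -big_filter; case: ifP => O_N.
  rewrite (_ : [seq _ <- _ | _] = [:: #|O|]) ?big_seq1 //.
  rewrite (eq_filter (a2 := pred1 #|O|)) => [|l]; last by rewrite /= eq_sym.
  by rewrite filter_pred1_uniq ?divisors_uniq // -dvdn_divisors.
rewrite big1_seq // => l /andP[_]; rewrite mem_filter -dvdn_divisors //.
by case: eqP O_N => //= <- ->.
Qed.

Lemma sum_by_parity (f : bool -> S -> S) l :
  \sum_(O in porbits rot | #|O| == l) f (orbit_sign sg a0 O) (orbit_weight a0 v O) =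
  \sum_(O in porbits rot | (#|O| == l) && (orbit_sign sg a0 O == false))
     f false (orbit_weight a0 v O) +
  \sum_(O in porbits rot | (#|O| == l) && (orbit_sign sg a0 O == true))
     f true (orbit_weight a0 v O).
Proof.
rewrite (bigID (fun O => orbit_sign sg a0 O == false)) /=; congr (_ + _).
  apply: eq_big => [O|O /andP[_ /eqP->]] //; by rewrite andbA.
apply: eq_big => [O|O /andP[_]]; last by case: orbit_sign.
by rewrite -andbA; case: orbit_sign.
Qed.

Lemma prod_orbit_sign (phi : A -> S) (O : {set L.-tuple A}) :
  \prod_(z in O) ((-1) ^+ sg (last a0 z) * phi (last a0 z)) =
  (-1) ^+ orbit_sign sg a0 O * \prod_(z in O) phi (last a0 z).
Proof.
rewrite big_split /=; congr (_ * _); rewrite /orbit_sign.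
by elim/big_rec2: _ => [|z e c _ ->]; rewrite ?expr0 // signr_addb.
Qed.

Lemma parity_sum_total i j : (0 < i)%N -> (i %| L)%N ->
  \sum_(l <- divisors i) (parity_sum false l (j * (i %/ l))%N +
    parity_sum true l (j * (i %/ l))%N) = (\sum_a v a ^+ j) ^+ i.
Proof.
move=> i_gt0 iL; rewrite -(sum_porbit_words a0 L_gt0) // sum_by_size //.
apply: eq_bigr => l _.
rewrite -(sum_by_parity (fun _ w => w ^+ (j * (i %/ l)) *+ l)).
apply: eq_bigr => O /andP[_ /eqP<-].
by rewrite prodrXl exprM.
Qed.

Hypothesis signed_sum0 : forall j, \sum_a (-1) ^+ sg a * v a ^+ j = 0.

(** The count of periodic words is applied to signed weights, whose total is 0; the sign of a class
    enters to the power [i %/ l]. *)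
Lemma parity_sum_signed i j : (0 < i)%N -> (i %| L)%N ->
  \sum_(l <- divisors i) (if odd (i %/ l)%N
    then parity_sum false l (j * (i %/ l))%N - parity_sum true l (j * (i %/ l))%N
    else parity_sum false l (j * (i %/ l))%N + parity_sum true l (j * (i %/ l))%N) = 0.
Proof.
move=> i_gt0 iL; transitivity ((\sum_a (-1) ^+ sg a * v a ^+ j) ^+ i); last first.
  by rewrite signed_sum0 expr0n eqn0Ngt i_gt0.
rewrite -(sum_porbit_words a0 L_gt0) // sum_by_size //; apply: eq_bigr => l _.
transitivity (\sum_(O in porbits rot | #|O| == l)
    (((-1) ^+ orbit_sign sg a0 O) ^+ (i %/ l) * orbit_weight a0 v O ^+ (j * (i %/ l)) *+ l)).
  rewrite (sum_by_parity (fun e w => ((-1) ^+ e) ^+ (i %/ l) * w ^+ (j * (i %/ l)) *+ l)).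
  rewrite /parity_sum expr0 expr1n expr1 -signr_odd.
  case: (odd _); first rewrite -sumrN; congr (_ + _); apply: eq_bigr => O _;
    by rewrite ?expr0 ?expr1 ?mul1r ?mulN1r ?mulNrn.
apply: eq_bigr => O /andP[_ /eqP<-].
rewrite (prod_orbit_sign (fun a => v a ^+ j)) prodrXl exprMn.
by rewrite (exprM (orbit_weight _ _ _)).
Qed.

Lemma parity_sum_balance i j : (0 < i)%N -> (i %| L)%N ->
  parity_sum false i j - parity_sum true i j +
  (if (2 %| i)%N then parity_sum true (i %/ 2)%N (2 * j)%N *+ 2 else 0) = 0.
Proof. by move: i j; apply: parity_inversion; apply: parity_sum_signed. Qed.

Lemma odd_parity_sum n i j : (forall l, (0 < l <= n)%N -> (l %| L)%N) -> (0 < i <= n)%N ->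
  parity_sum true i j *+ 2 =
  \sum_(d <- divisors i | odd d)
    (\sum_a v a ^+ (j * d)) ^+ (i %/ d) *~ moebius d.
Proof.
move=> dvdL; move: i j.
pose G i j := parity_sum true i j *+ 2.
pose T i j := (\sum_a v a ^+ j) ^+ i.
suff defT i j : (0 < i <= n)%N ->
    T i j = \sum_(m <- divisors i | odd m) G (i %/ m)%N (j * m)%N.
  by move=> i j i_n; rewrite -[LHS](odd_moebius_inversion defT j i_n).
move=> /[dup] i_n /andP[i_gt0 _]; have iL := dvdL _ i_n.
(* Subtracting the signed sum, which is 0, from the total leaves [2 o] for odd quotients and nothing
   for even ones. *)
rewrite /T -parity_sum_total // -[LHS]subr0 -[X in _ - X](parity_sum_signed j i_gt0 iL) -sumrB.
rewrite sum_codivisor // [RHS]big_mkcond [LHS]big_seq [RHS]big_seq.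
apply: eq_bigr => d; rewrite -dvdn_divisors // => d_i.
rewrite divnA // mulKn //; case: (odd d); last by rewrite subrr.
by rewrite opprB addrC addrA subrK /G mulr2n.
Qed.

End ParitySums.

(** * The generating function *)

Section Coefficients.
Variables (S : comNzRingType) (n : nat).

Section Orbits.
Variables (A : finType) (sg : A -> bool) (L : nat) (a0 : A).
Hypothesis L_gt0 : (0 < L)%N.
Hypothesis dvdL : forall l, (0 < l <= n)%N -> (l %| L)%N.
Variables (v : A -> S) (x : nat -> S).
Hypothesis signed_sum0 : forall j, \sum_a (-1) ^+ sg a * v a ^+ j = 0.
Local Notation rot := (rotp A L).
Local Notation par e := (parity_sum sg L a0 v e).

Lemma coef_sum_orbit_logderiv i : (i < n)%N ->
  (\sum_(O in porbits rot) orbit_logderiv sg n a0 v x O)`_i =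
  \sum_(c <- divisors i.+1 | odd (i.+1 %/ c))
    x c ^+ (i.+1 %/ c) * (par true c (i.+1 %/ c)%N *+ 2).
Proof.
move=> lti; set N := i.+1; have N_gt0 : (0 < N)%N by [].
pose f e c (w : S) := (if e then - (- (w * x c)) ^+ (N %/ c) *+ c
                       else (w * x c) ^+ (N %/ c) *+ c).
pose g (O : {set L.-tuple A}) := if orbit_sign sg a0 O
  then (orbit_weight a0 v O ^+ 2 * x #|O|.*2) ^+ (N %/ #|O|.*2) *+ #|O|.*2 else 0.
have coef_O O : O \in porbits rot -> (orbit_logderiv sg n a0 v x O)`_i =
    (if (#|O| %| N)%N then f (orbit_sign sg a0 O) #|O| (orbit_weight a0 v O) else 0) +
    (if (#|O|.*2 %| N)%N then g O else 0).
  move=> rotO; rewrite coef_orbit_logderiv //; last first.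
    by have /imsetP[s _ ->] := rotO; apply: card_porbit_gt0.
  rewrite /f /g -/N; case: orbit_sign; last by rewrite if_same addr0.
  by rewrite addrC; congr (_ + _); case: ifP; rewrite ?oppr0 // mulNrn.
rewrite coef_sum (eq_bigr _ coef_O) big_split /=.
rewrite -[X in X + _]big_mkcondr -[X in _ + X]big_mkcondr /=.
rewrite sum_by_size //.
(* Terms are collected by the index [c] of [x c]; here the variable [x #|O|.*2] comes from negative
   classes of size [c %/ 2]. *)
have -> : \sum_(O in porbits rot | (#|O|.*2 %| N)%N) g O =
    \sum_(c <- divisors N | (2 %| c)%N)
      x c ^+ (N %/ c) * (par true (c %/ 2)%N (2 * (N %/ c))%N *+ 2).
  have [N2|N_odd] := boolP (2 %| N)%N; last first.
    rewrite big1 => [|O /andP[_ O2]]; last first.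
      by case/negP: N_odd; apply: dvdn_trans O2; rewrite -mul2n dvdn_mulr.
    rewrite big1_seq // => c /andP[c2]; rewrite -dvdn_divisors // => cN.
    by case/negP: N_odd; apply: dvdn_trans cN.
  have N2_gt0 : (0 < N %/ 2)%N by rewrite divn_gt0 // dvdn_leq.
  transitivity (\sum_(O in porbits rot | (#|O| %| N %/ 2)%N) g O).
    by apply: eq_bigl => O; rewrite dvdn_divRL // muln2.
  rewrite sum_by_size //.
  rewrite [RHS](eq_bigl (fun c => (2 %| c)%N && predT c)) => [|c]; last by rewrite andbT.
  rewrite sum_multiples //; apply: eq_bigr => m _; rewrite mulKn // /parity_sum.
  rewrite -sumrMnl mulr_sumr [LHS]big_mkcondr [RHS]big_mkcondr /=.
  apply: eq_bigr => O _; rewrite /g mul2n; case: eqP => //= <-.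
  case: orbit_sign => //=; rewrite exprMn mulrC -mulrnAr -mulrnA muln2.
  by rewrite -exprM.
rewrite [X in _ + X]big_mkcond [RHS]big_mkcond -big_split /= [LHS]big_seq [RHS]big_seq.
apply: eq_bigr => c; rewrite -dvdn_divisors // => cN; have c_gt0 := dvdn_gt0 N_gt0 cN.
have c_le : (0 < c <= n)%N by rewrite c_gt0 (leq_trans _ lti) // dvdn_leq.
set j := (N %/ c)%N.
have -> : \sum_(O in porbits rot | #|O| == c)
    f (orbit_sign sg a0 O) #|O| (orbit_weight a0 v O) =
    x c ^+ j * (par false c j - (-1) ^+ j * par true c j).
  rewrite (eq_bigr (fun O => f (orbit_sign sg a0 O) c (orbit_weight a0 v O))); last first.
    by move=> O /andP[_ /eqP->].
  rewrite (sum_by_parity sg L a0 v (fun e w => f e c w)) mulrBr; congr (_ + _).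
    rewrite /parity_sum mulr_sumr; apply: eq_bigr => O _.
    by rewrite /f exprMn mulrC mulrnAr.
  rewrite /parity_sum mulrCA mulr_sumr -mulNr mulr_sumr; apply: eq_bigr => O _.
  rewrite /f (exprNn (_ * x c)) exprMn (mulrC (_ ^+ _) (x c ^+ _)) mulNr mulNrn.
  by rewrite !mulrnAr.
have := parity_sum_balance a0 L_gt0 signed_sum0 j c_gt0 (dvdL c_le).
set t := if _ then _ else 0 => balance.
have -> : (if (2 %| c)%N then
    x c ^+ j * (par true (c %/ 2)%N (2 * j)%N *+ 2) else 0) = x c ^+ j * t.
  by rewrite /t; case: ifP; rewrite ?mulr0.
(* For even [j] the bracket is the balance relation, hence 0; for odd [j] it exceeds that relation
   by [2 o]. *)
rewrite -mulrDr -signr_odd; case: (odd j); last by rewrite expr0 mul1r balance mulr0.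
rewrite expr1 mulN1r opprK; congr (_ * _).
by rewrite -[RHS]add0r -balance mulr2n [RHS]addrAC [in RHS]addrA subrK.
Qed.

End Orbits.

Lemma coef_deriv_double_sum (a : nat -> nat -> S) i : (i < n)%N ->
  (\sum_(i0 < n) \sum_(j < n.+1 | odd j) (a i0.+1 j *: 'X^(i0.+1 * j))^`())`_i =
  \sum_(c <- divisors i.+1 | odd (i.+1 %/ c)) a c (i.+1 %/ c)%N *+ i.+1.
Proof.
move=> lti; set N := i.+1.
rewrite -(@sum_divisors_ord _ N n) // [RHS]big_mkcond [RHS]big_ord_recl /= add0r.
rewrite coef_sum; apply: eq_bigr => i0 _; rewrite coef_sum -[bump 0 i0]/(i0.+1).
under eq_bigr => j _ do rewrite coef_deriv coefZ coefXn -/N.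
case: ifP => [/andP[/dvdnP[j0 def_N] odd_N]|ndvd].
  have j0_gt0 : (0 < j0)%N by case: j0 def_N {odd_N}.
  have lt_j0 : (j0 < n.+1)%N.
    by rewrite ltnS; apply: leq_trans lti; rewrite -/N def_N leq_pmulr.
  have div_N : (N %/ i0.+1)%N = j0 by rewrite def_N mulnK.
  rewrite div_N in odd_N *.
  rewrite (bigD1 (Ordinal lt_j0)) //= mulnC -def_N eqxx mulr1 big1 ?addr0 // => j /andP[_ neq].
  case: eqP => [eq_N|]; last by rewrite mulr0 mul0rn.
  by case/eqP: neq; apply: val_inj; rewrite /= -div_N eq_N mulKn.
rewrite big1 // => j odd_j; case: eqP => [eq_N|]; last by rewrite mulr0 mul0rn.
by move: ndvd; rewrite eq_N dvdn_mulr // mulKn // odd_j.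
Qed.

End Coefficients.

Section GeneratingFunction.
Variables (R : realFieldType) (k : nat) (y : 'I_k -> R) (n : nat).
Local Notation letters := ('I_k * bool)%type.
Local Notation S := {mpoly R[n]}.

Definition letter_weight (a : letters) : S := (y a.1 / 2)%:MP_[n].

(** Extension by 0 to indices above [n], so that [x l.*2] is meaningful for every class. *)
Definition cycle_var (i : nat) : S := if insub i.-1 is Some i0 then 'X_i0 else 0.

Lemma cycle_varE (i0 : 'I_n) : cycle_var i0.+1 = 'X_i0.
Proof. by rewrite /cycle_var /= valK. Qed.

Lemma mpoly_torsion_free m (z : S) : z *+ m.+1 = 0 -> z = 0.
Proof.
move=> z0; have : ((m.+1)%:R : R)^-1 *: (z *+ m.+1) = 0 by rewrite z0 scaler0.
by rewrite -scaler_nat scalerA mulVf ?scale1r // pnatr_eq0.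
Qed.

Lemma sum_letters (V : zmodType) (F : letters -> V) :
  \sum_a F a = \sum_(i < k) (F (i, false) + F (i, true)).
Proof.
rewrite (eq_bigr (fun a => F (a.1, a.2))) => [|[i b] _ //].
rewrite -(pair_bigA _ (fun i b => F (i, b))) /=; apply: eq_bigr => i _.
by rewrite big_bool /= addrC.
Qed.

Lemma signed_letter_weight0 j : \sum_a (-1) ^+ (snd a : bool) * letter_weight a ^+ j = 0.
Proof.
rewrite sum_letters big1 // => i _ /=.
by rewrite expr0 expr1 mul1r mulN1r subrr.
Qed.

Lemma sum_letter_weight j :
  \sum_a letter_weight a ^+ j = (2 * psum y j / 2 ^+ j)%:MP_[n].
Proof.
rewrite sum_letters /psum mulr_sumr mulr_suml rmorph_sum; apply: eq_bigr => i _ /=.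
rewrite /letter_weight /= -rmorphXn -rmorphD /=; congr _%:MP; rewrite expr_div_n.
by rewrite mulr2n mulrDl mul1r mulrDl.
Qed.

Lemma Ssum_parity a0 L i j : (0 < L)%N -> (forall l, (0 < l <= n)%N -> (l %| L)%N) ->
  (0 < i <= n)%N ->
  parity_sum snd L a0 letter_weight true i j *+ 2 = (Ssum y i j / 2 ^+ (i * j))%:MP_[n].
Proof.
move=> L_gt0 dvdL i_n; have /andP[i_gt0 _] := i_n.
rewrite (odd_parity_sum a0 L_gt0 signed_letter_weight0 j dvdL i_n) /Ssum.
rewrite (@sum_divisors_ord _ i i odd
  (fun d => (moebius d)%:~R * (2 * psum y (j * d)) ^+ (i %/ d))) ?i_gt0 //=.
rewrite mulr_suml rmorph_sum /= [LHS]big_seq_cond [RHS]big_seq_cond.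
apply: eq_bigr => d /andP[+ _]; rewrite -dvdn_divisors // => d_i.
rewrite sum_letter_weight -rmorphXn -rmorphMz /=; congr _%:MP.
(* The power of 2 does not depend on [d], because [(j * d) * (i %/ d) = i * j]. *)
rewrite expr_div_n -exprM -mulnA [(d * _)%N]mulnC divnK // (mulnC j i).
by rewrite -mulrzr mulrC mulrA.
Qed.

(** Both series have constant term 1 and the same logarithmic derivative. The ranking is arbitrary,
    so that one statement serves both shuffles. *)
Lemma sum_gen_shuffle (rk : letters -> nat) : letters -> injective rk ->
  \sum_(J : {ffun 'I_n -> letters})
    word_prob y J *: \prod_(i < n) 'X_i ^+ ncycles (gen_shuffle snd rk J) i.+1 =
  rhs_coef y n.
Proof.
move=> a0 rk_inj.
have L_gt0 : (0 < n`!)%N by apply: fact_gt0.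
have dvdL l : (0 < l <= n)%N -> (l %| n`!)%N by apply: dvdn_fact.
transitivity (\sum_(J : {ffun 'I_n -> letters}) \prod_p letter_weight (J p) *
    \prod_(i < n) cycle_var i.+1 ^+ ncycles (gen_shuffle snd rk J) i.+1).
  apply: eq_bigr => J _; rewrite -mul_mpolyC /word_prob rmorph_prod; congr (_ * _).
  by apply: eq_bigr => i _; rewrite cycle_varE.
rewrite (sum_shuffles snd a0 rk_inj L_gt0 (@expg_fact n)) /rhs_coef.
pose K i j : R := Ssum y i j / (2 ^+ (i * j) * (i * j)%:R).
pose c i j : S := K i j *: cycle_var i ^+ j.
have rhsE (i0 : 'I_n) j : rhs_term y i0 j = c i0.+1 j *: 'X^(i0.+1 * j).
  by rewrite /rhs_term /c cycle_varE mul_polyC.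
have e_gt0 (i0 : 'I_n) j : odd j -> (0 < i0.+1 * j)%N.
  by rewrite muln_gt0 /=; case: j.
rewrite [in RHS](eq_bigr (fun i0 : 'I_n => \prod_(j < n.+1 | odd j)
  texp n (c i0.+1 j *: 'X^(i0.+1 * j)))); last first.
  by move=> i0 _; apply: eq_bigr => j _; rewrite rhsE.
have O_gt0 O : O \in porbits (rotp letters n`!) -> (0 < #|O|)%N.
  by case/imsetP=> s _ ->; apply: card_porbit_gt0.
apply: (@is_logderiv_inj _ n _ _
  (\sum_(O in porbits (rotp letters n`!)) orbit_logderiv snd n a0 letter_weight cycle_var O)
  (\sum_(i0 < n) \sum_(j < n.+1 | odd j) (c i0.+1 j *: 'X^(i0.+1 * j))^`())) => //.
- exact: mpoly_torsion_free.
- by apply: is_logderiv_prod => O /O_gt0 O0; apply: is_logderiv_orbit_poly.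
- apply: is_logderiv_prod => i0 _; apply: is_logderiv_prod => j odd_j.
  exact: is_logderiv_texp (e_gt0 _ _ odd_j).
- move=> i lti; rewrite (coef_sum_orbit_logderiv _ L_gt0 dvdL _ signed_letter_weight0 lti).
  rewrite coef_deriv_double_sum //; set N := i.+1.
  rewrite [LHS]big_seq_cond [RHS]big_seq_cond; apply: eq_bigr => d /andP[+ odd_d].
  rewrite -dvdn_divisors // => d_N; have d_gt0 : (0 < d)%N := dvdn_gt0 (ltn0Sn i) d_N.
  have d_n : (0 < d <= n)%N by rewrite d_gt0 (leq_trans _ lti) // dvdn_leq.
  rewrite (Ssum_parity a0 _ L_gt0 dvdL d_n) mulrC mul_mpolyC /c -scaler_nat scalerA.
  have dj : (d * (N %/ d))%N = N by rewrite mulnC divnK.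
  (* The factor [N] produced by differentiation cancels the denominator [i * j] of the exponent. *)
  congr (_ *: _); rewrite /K dj [RHS]mulrC -mulrA; congr (_ * _).
  by rewrite invfM -mulrA mulVf ?mulr1 // pnatr_eq0.
- rewrite !coef0_prod [LHS]big1 => [|O /O_gt0 O0]; last exact: coef0_orbit_poly.
  rewrite big1 // => i0 _; rewrite coef0_prod big1 // => j odd_j.
  exact: coef0_texp (e_gt0 _ _ odd_j).
Qed.

(** Reversing the positions turns increasing placement into decreasing placement; the change of sign
    compensates for this. *)
Definition rev_flip (J : {ffun 'I_n -> letters}) : {ffun 'I_n -> letters} :=
  [ffun p => ((J (rev_ord p)).1, ~~ (J (rev_ord p)).2)].

Lemma rev_flipK : involutive rev_flip.
Proof.
by move=> J; apply/ffunP => p; rewrite !ffunE /= rev_ordK negbK; case: (J p).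
Qed.

(** The order [-1 < 1 < -2 < 2 < ...], in which a flipped letter keeps the rank of the original. *)
Definition flipped_rank (a : letters) : nat := letter_rank (a.1, ~~ a.2).

Lemma letter_rank_inj : injective (@letter_rank k).
Proof.
move=> [i b] [i' b']; rewrite /letter_rank /= => eq_r.
have eq_b : b = b'.
  by have := congr1 odd eq_r; rewrite !mul2n !oddD !odd_double !oddb.
move: eq_r; rewrite eq_b => /addIn/eqP; rewrite eqn_pmul2l // => /eqP/val_inj->.
by [].
Qed.

Lemma flipped_rank_inj : injective flipped_rank.
Proof. by move=> [i b] [i' b'] /letter_rank_inj [-> /negb_inj->]. Qed.

Lemma shuffle_permE (J : {ffun 'I_n -> letters}) :
  shuffle_perm J = gen_shuffle snd (@letter_rank k) J.
Proof. by []. Qed.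

Lemma card_rev_ord (P : pred 'I_n) : #|[pred q | P (rev_ord q)]| = #|P|.
Proof.
rewrite -!sum1_card (reindex_inj (@rev_ord_inj n)) /=; apply: eq_bigl => q.
by rewrite [LHS]unfold_in /= rev_ordK.
Qed.

(* The ranks of i and -i get exchanged here: this is why an arbitrary order of
   the letters is needed. *)
Lemma w0_shuffle_perm (J : {ffun 'I_n -> letters}) :
  (w0 n * shuffle_perm J)%g = gen_shuffle snd flipped_rank (rev_flip J).
Proof.
apply/permP => p; apply: val_inj; rewrite /= permM shuffle_permE.
rewrite (gen_shuffleE snd letter_rank_inj) (gen_shuffleE snd flipped_rank_inj).
rewrite /w0 permE /gen_shuffle_val !ffunE /=.
set a := J (rev_ord p).
have rk_a b : flipped_rank (b.1, ~~ b.2) = letter_rank b.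
  by case: b => i b; rewrite /flipped_rank negbK.
have eq_flip b : ((b.1, ~~ b.2) == (a.1, ~~ a.2)) = (b == a).
  case: b a => i b [i' b']; rewrite !xpair_eqE /= ; by case: b b' => [] [].
congr addn.
  rewrite -card_rev_ord; apply: eq_card => q; rewrite !inE !ffunE !rk_a.
  by [].
rewrite if_neg; move: eq_flip; case: ifP => _ eq_flip;
  rewrite -card_rev_ord; apply: eq_card => q;
  by rewrite !inE !ffunE eq_flip /= ltn_sub2lE // ltnS.
Qed.

End GeneratingFunction.

Theorem theorem5p6 (R : realFieldType) (k : nat) (y : 'I_k -> R) :
  (forall i, 0 <= y i) -> \sum_(i < k) y i = 1 ->
  forall n : nat,
    lhs_coef y (fun w : {perm 'I_n} => w) = rhs_coef y n /\
    lhs_coef y (fun w : {perm 'I_n} => (w0 n * w)%g) = rhs_coef y n.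
Proof.
move=> _ sum_y n.
have a0 : 'I_k * bool.
  (* A letter exists because an empty sum of the [y i] could not equal 1. *)
  case: k y sum_y => [|k'] y sum_y; last by split; [apply: ord0 | apply: false].
  by move/eqP: sum_y; rewrite big_ord0 eq_sym oner_eq0.
split; rewrite /lhs_coef.
  rewrite -(sum_gen_shuffle y n a0 (@letter_rank_inj k)); apply: eq_bigr => J _.
  by rewrite shuffle_permE.
rewrite -(sum_gen_shuffle y n a0 (@flipped_rank_inj k)).
(* [rev_flip] preserves [word_prob], since [i] and [-i] have equal weight. *)
rewrite [RHS](reindex_inj (inv_inj (@rev_flipK k n))); apply: eq_bigr => J _.
rewrite w0_shuffle_perm; congr (_ *: _).
rewrite /word_prob (reindex_inj (@rev_ord_inj n)); apply: eq_bigr => p _.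
by rewrite ffunE.
Qed.
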